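(* Let $\mathfrak F\subset\mathbb S_{++}^d$ be a nonempty, closed, geodesically convex smooth embedded submanifold. Let $H_1,\dots,H_q\in\mathbb S_{++}^d$, let $\phi_1,\dots,\phi_q:\mathbb R^d\to\mathbb R$ be convex and permutation invariant, let $\rho:\mathbb R^q\to\mathbb R$ be convex and nondecreasing in every coordinate, and set $\Omega_a(G)=\phi_a(\log\lambda(G^{-1/2}H_aG^{-1/2}))$ and $\mathcal J(G)=\rho(\Omega_1(G),\ldots,\Omega_q(G))$. A point $G\in\mathfrak F$ globally minimizes $\mathcal J$ over $\mathfrak F$ if and only if there exist $$\theta\in\partial\rho(\Omega_1(G),\ldots,\Omega_q(G)),\qquad Z_a\in\mathfrak Z_a(G)\quad(a=1,\dots,q),$$ such that $$\sum_{a=1}^q\theta_aZ_a\in\widehat N_G\mathfrak F.$$ For a single $H\in\mathbb S_{++}^d$ and a single convex permutation-invariant $\phi:\mathbb R^d\to\mathbb R$, let $P=P_{\mathfrak F}(H)$ be the unique nearest point to $H$ in $\mathfrak F$ for $d_{\mathrm{AI}}$, and set $S=P^{-1/2}HP^{-1/2}$. Then $\log S\in\widehat N_P\mathfrak F$, and $P$ also minimizes $\Omega_{\phi,H}(G)=\phi(\log\lambda(G^{-1/2}HG^{-1/2}))$ over $\mathfrak F$ if and only if $$\mathfrak Z_\phi(P)\cap\widehat N_P\mathfrak F\ne\emptyset.$$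
   Context: $\mathbb S^d$ denotes real symmetric $d\times d$ matrices with Frobenius inner product, $\mathbb S_{++}^d$ the positive-definite ones with the affine-invariant Riemannian metric $\|Z\|_{S,\mathrm{AI}}=\|S^{-1/2}ZS^{-1/2}\|_F$ and distance $d_{\mathrm{AI}}(S_0,S_1)=\|\log(S_0^{-1/2}S_1S_0^{-1/2})\|_F$; geodesic convexity is with respect to this metric. $\lambda(X)\in\mathbb R^d$ is the eigenvalue vector of $X$ (in any order), with $\log$ acting entrywise. The whitened tangent and normal spaces are $\widehat T_G\mathfrak F=\{G^{-1/2}UG^{-1/2}:U\in T_G\mathfrak F\}\subset\mathbb S^d$ and $\widehat N_G\mathfrak F=(\widehat T_G\mathfrak F)^\perp$, the Frobenius orthogonal complement in $\mathbb S^d$. With $S_a=G^{-1/2}H_aG^{-1/2}$, $\mathfrak Z_a(G)=\partial_X[\phi_a(\lambda(X))]_{X=\log S_a}$ is the Euclidean (Frobenius) convex subdifferential of the spectral function $X\mapsto\phi_a(\lambda(X))$ on $\mathbb S^d$ at $X=\log S_a$. For the single-$H$ case, $\mathfrak Z_\phi(P)=\partial_X[\phi(\lambda(X))]_{X=\log S}$. $\partial\rho$ is the usual convex subdifferential. *)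

(* Defs.v *)
From HB Require Import structures.
From mathcomp Require Import all_boot all_order all_algebra perm.
From mathcomp Require Import all_classical all_reals all_analysis.

Set Implicit Arguments.
Unset Strict Implicit.
Unset Printing Implicit Defensive.

Import Order.TTheory GRing.Theory Num.Theory.
Import numFieldNormedType.Exports.

Local Open Scope classical_set_scope.
Local Open Scope ring_scope.

Section FrobeniusConvex.
Context {R : realType} {m n : nat}.

Definition frob (A B : 'M[R]_(m, n)) : R := \tr (A^T *m B).

Definition fnorm (A : 'M[R]_(m, n)) : R := Num.sqrt (frob A A).

(* Convex subdifferential of [f] on the linear subspace [E], for the inner
   product [frob]; on row vectors [frob] is the Euclidean inner product. *)
Definition subdifferential (E : set 'M[R]_(m, n)) (f : 'M[R]_(m, n) -> R)
    (X : 'M[R]_(m, n)) : set 'M[R]_(m, n) :=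
  [set Z | E Z /\ forall Y, E Y -> f X + frob Z (Y - X) <= f Y].

End FrobeniusConvex.

Definition permutation_invariant {R : realType} {d : nat}
    (phi : 'rV[R]_d -> R) : Prop :=
  forall (s : 'S_d) x, phi (col_perm s x) = phi x.

Definition coordinatewise_nondecreasing {R : realType} {q : nat}
    (rho : 'rV[R]_q -> R) : Prop :=
  forall (i : 'I_q) (x y : 'rV[R]_q),
    (forall j, j != i -> x 0 j = y 0 j) -> x 0 i <= y 0 i -> rho x <= rho y.

Section SpectralCalculus.
Context {R : realType} {d : nat}.
Implicit Types (A B S Z : 'M[R]_d).

Definition sym : set 'M[R]_d := [set A | A^T = A].

Definition spd : set 'M[R]_d :=
  [set A | sym A /\ forall v : 'rV[R]_d, v != 0 -> 0 < (v *m A *m v^T) 0 0].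

(* A vector listing the eigenvalues with multiplicity, in an unspecified
   order; meaningful when the characteristic polynomial splits over [R], in
   particular for symmetric matrices. *)
Definition eigvals A : 'rV[R]_d :=
  xget (0 : 'rV[R]_d) [set v : 'rV[R]_d | char_poly A = \prod_(i < d) ('X - (v 0 i)%:P)].

(* Functional calculus of a symmetric matrix: the result does not depend on
   the orthogonal diagonalization used. *)
Definition mxfun (f : R -> R) A : 'M[R]_d :=
  xget (0 : 'M[R]_d) [set B : 'M[R]_d | exists (U : 'M[R]_d) (v : 'rV[R]_d),
    [/\ U *m U^T = 1%:M, A = U *m diag_mx v *m U^T
      & B = U *m diag_mx (map_mx f v) *m U^T]].

Definition mxlog : 'M[R]_d -> 'M[R]_d := mxfun (@ln R).

Definition mxinvsqrt : 'M[R]_d -> 'M[R]_d := mxfun (fun x => x `^ (- 2^-1)).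

Definition whiten (G A : 'M[R]_d) : 'M[R]_d :=
  mxinvsqrt G *m A *m mxinvsqrt G.

Definition dAI (S0 S1 : 'M[R]_d) : R := fnorm (mxlog (whiten S0 S1)).

End SpectralCalculus.

Section Geometry.
Context {R : realType}.

(* [f] is C^k on the open set [U]; in finite dimension, being differentiable
   with all directional derivatives of class C^k is being of class C^(k+1). *)
Fixpoint Ck_on {V W : normedModType R} (k : nat) (U : set V) (f : V -> W) : Prop :=
  match k with
  | 0 => forall x, U x -> {for x, continuous f}
  | k'.+1 => (forall x, U x -> differentiable f x) /\
             forall v, Ck_on k' U ('D_v f)
  end.

Definition smooth_on {V W : normedModType R} (U : set V) (f : V -> W) : Prop :=
  forall k, Ck_on k U f.

Context {d : nat}.
Implicit Types (F : set 'M[R]_d) (G : 'M[R]_d).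

(* Around each point, [F] is the homeomorphic image of an open subset of R^k
   under a smooth immersion. The parametrizations take values in [F], so for
   [F `<=` spd] it is immaterial whether the ambient manifold is [spd] or the
   space of all matrices. *)
Definition embedded_submanifold (k : nat) F : Prop :=
  forall G, F G ->
  exists (N : set 'M[R]_d) (W : set 'rV[R]_k)
         (f : 'rV[R]_k -> 'M[R]_d) (g : 'M[R]_d -> 'rV[R]_k),
    [/\ open N /\ N G,
        open W /\ f @` W = F `&` N,
        smooth_on W f /\ (forall x, W x -> injective ('d f x)),
        forall x, W x -> g (f x) = x
      & {within F `&` N, continuous g}].

(* Velocities at [G] of smooth curves in [F]. *)
Definition tangent F G : set 'M[R]_d :=
  [set U | exists (gamma : R^o -> 'M[R]_d) (e : R),
    [/\ 0 < e, smooth_on [set t : R^o | `|t| < e] gamma,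
        forall t, `|t| < e -> F (gamma t),
        gamma 0 = G & 'D_1 gamma 0 = U]].

Definition whitened_tangent F G : set 'M[R]_d := whiten G @` tangent F G.

Definition whitened_normal F G : set 'M[R]_d :=
  [set Z | sym Z /\ forall V, whitened_tangent F G V -> frob Z V = 0].

(* The affine-invariant metric makes [spd] a Hadamard manifold with distance
   [dAI], so its geodesic segments are the constant-speed curves that realize
   the distance. *)
Definition geodesic_segment (gamma : R -> 'M[R]_d) : Prop :=
  (forall t, 0 <= t <= 1 -> spd (gamma t)) /\
  (forall s t, 0 <= s <= 1 -> 0 <= t <= 1 ->
     dAI (gamma s) (gamma t) = `|s - t| * dAI (gamma 0) (gamma 1)).

Definition geodesically_convex F : Prop :=
  forall gamma, geodesic_segment gamma -> F (gamma 0) -> F (gamma 1) ->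
  forall t, 0 <= t <= 1 -> F (gamma t).

Definition closed_in_spd F : Prop := closure F `&` spd `<=` F.

Definition minimizes_over F (f : 'M[R]_d -> R) G : Prop :=
  F G /\ forall G', F G' -> f G <= f G'.

Definition nearest_point F (H P : 'M[R]_d) : Prop := minimizes_over F (dAI H) P.

Definition Omega (phi : 'rV[R]_d -> R) (H G : 'M[R]_d) : R :=
  phi (map_mx (@ln R) (eigvals (whiten G H))).

Definition spectral_subdiff (phi : 'rV[R]_d -> R) (H G : 'M[R]_d) : set 'M[R]_d :=
  subdifferential sym (fun X => phi (eigvals X)) (mxlog (whiten G H)).

Definition Omegas {q : nat} (phi : 'I_q -> 'rV[R]_d -> R) (H : 'I_q -> 'M[R]_d)
    (G : 'M[R]_d) : 'rV[R]_q :=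
  \row_a Omega (phi a) (H a) G.

End Geometry.

(* Main.v *)
Require Import Defs.
From HB Require Import structures.
From mathcomp Require Import all_boot all_order all_algebra perm.
From mathcomp Require Import all_classical all_reals all_analysis.
From mathcomp Require Import ring lra.

Set Implicit Arguments.
Unset Strict Implicit.
Unset Printing Implicit Defensive.

Import Order.TTheory GRing.Theory Num.Theory.
Import numFieldNormedType.Exports.

Local Open Scope classical_set_scope.
Local Open Scope ring_scope.

(** Along the affine-invariant geometry, [Omega phi H] behaves to first order like
    the Euclidean convex function [X |-> phi (eigvals X)] near
    [L := mxlog (whiten G H)], and both directions rest on this comparison.

    Geodesic convexity. Going from [G] to [G'] along a geodesic with whitened
    velocity [X := mxlog (whiten G G')] turns [whiten G H], up to similarity, into
    [exp L *m exp (- X)]. If [Z] is a subgradient of the spectral function at [L],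
    then [Z] and [L] are diagonal in a common orthonormal basis, with both diagonals
    sorted: [Z] attains equality in von Neumann's trace inequality
    ([von_neumann_eq], [spectral_subgradient_diag]). In this basis the leading
    [k x k] minors of [exp (L / 2) *m exp (- X) *m exp (L / 2)] are bounded above by
    the products of its [k] largest eigenvalues, by interlacing, and below by
    [exp (\sum_(i < k) (L - X)_ii)], by concavity of the logarithm. Summation by parts
    against the sorted eigenvalues of [Z] gives
    [Omega phi H G - frob Z X <= Omega phi H G'] ([exp_majorization],
    [Omega_subgradient]).

    Sufficiency. As [F] is geodesically convex, the geodesic to a competitor [G']
    stays in [F]; it is a curve known on one side of [G] only, but its velocity is
    tangent all the same ([immersion_velocity], [tangent_space]), hence orthogonal to
    a normal combination of the subgradients. The inequality above, weighted by the
    nonnegative multipliers, compares the objective at [G] and [G'].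

    Necessity. Let [c] be a curve in [F] with [c 0 = G] and whitened velocity [V].
    The same inequality, based at [c t] and aimed at [G], combined with minimality at
    [G], shows that moving the logarithm at [c t] by [mxlog (whiten (c t) G) / t] does
    not decrease the objective ([first_order_step]). The displacement tends to [- V], so
    the convex function [X |-> rho (phi_a (eigvals (L_a - X)))_a] is minimal at [0] on
    the tangent space ([tangent_variation]). A Hahn-Banach argument for
    [(u, W) |-> rho (phi_a (eigvals (L_a + W_a)) + u_a)_a], along the diagonal of the
    tangent space, separates the multipliers [theta] from the matrices [Z_a]
    ([lagrange_multipliers]).

    Nearest point. The squared distance to [H] is [Omega] for the squared Euclidean
    norm, whose spectral function has the gradient [2 *: L]; so the criterion applied
    to it says that [L] is normal. A nearest point exists because, in logarithmic
    coordinates at [H], it is an element of least norm of a closed set. It is unique: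
    at the midpoint of two nearest points the inequality above, kept with its
    quadratic remainder, forces [H] to have the same whitened spectrum at the three
    points, and equality of the traces forces the three points to coincide
    ([nearest_point_unique]). *)

(** * Frobenius inner product and orthogonal matrices *)

Section FrobeniusAlgebra.
Context {R : realType}.

Section Rect.
Context {m n : nat}.
Implicit Types A B C : 'M[R]_(m, n).

Lemma frobE A B : frob A B = \sum_i \sum_j A i j * B i j.
Proof.
rewrite /frob /mxtrace exchange_big; apply: eq_bigr => j _.
by rewrite mxE; apply: eq_bigr => i _; rewrite mxE.
Qed.

Lemma frobC A B : frob A B = frob B A.
Proof. by rewrite !frobE; do 2 (apply: eq_bigr => ? _); rewrite mulrC. Qed.

Lemma frobDr A B C : frob A (B + C) = frob A B + frob A C.
Proof. by rewrite /frob mulmxDr mxtraceD. Qed.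

Lemma frobDl A B C : frob (A + B) C = frob A C + frob B C.
Proof. by rewrite frobC frobDr !(frobC C). Qed.

Lemma frobZr a A B : frob A (a *: B) = a * frob A B.
Proof. by rewrite /frob -scalemxAr mxtraceZ. Qed.

Lemma frobZl a A B : frob (a *: A) B = a * frob A B.
Proof. by rewrite frobC frobZr frobC. Qed.

Lemma frobNr A B : frob A (- B) = - frob A B.
Proof. by rewrite -scaleN1r frobZr mulN1r. Qed.

Lemma frobNl A B : frob (- A) B = - frob A B.
Proof. by rewrite frobC frobNr frobC. Qed.

Lemma frobBr A B C : frob A (B - C) = frob A B - frob A C.
Proof. by rewrite frobDr frobNr. Qed.

Lemma frobBl A B C : frob (A - B) C = frob A C - frob B C.
Proof. by rewrite frobDl frobNl. Qed.

Lemma frob0r A : frob A 0 = 0.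
Proof. by rewrite /frob mulmx0 mxtrace0. Qed.

Lemma frob0l A : frob 0 A = 0.
Proof. by rewrite frobC frob0r. Qed.

Lemma frob_suml I (r : seq I) (P : pred I) (E : I -> 'M[R]_(m, n)) B :
  frob (\sum_(i <- r | P i) E i) B = \sum_(i <- r | P i) frob (E i) B.
Proof. by elim/big_rec2: _ => [|i x y _ <-]; rewrite ?frob0l ?frobDl. Qed.

Lemma frob_ge0 A : 0 <= frob A A.
Proof. by rewrite frobE; do 2 (apply: sumr_ge0 => ? _); rewrite -expr2 sqr_ge0. Qed.

Lemma frob_coord_le A i j : (A i j) ^+ 2 <= frob A A.
Proof.
rewrite frobE (bigD1 i) //= (bigD1 j) //= -expr2 -addrA lerDl addr_ge0 //.
  by apply: sumr_ge0 => ? _; rewrite -expr2 sqr_ge0.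
by do 2 (apply: sumr_ge0 => ? _); rewrite -expr2 sqr_ge0.
Qed.

Lemma frob_eq0 A : frob A A = 0 -> A = 0.
Proof.
move=> A0; apply/matrixP => i j; rewrite mxE; apply/eqP.
by rewrite -sqrf_eq0 eq_le sqr_ge0 -A0 frob_coord_le.
Qed.

Lemma frob_gt0 A : A != 0 -> 0 < frob A A.
Proof. by move=> A0; rewrite lt0r frob_ge0 andbT; apply: contra A0 => /eqP/frob_eq0->. Qed.

End Rect.

Lemma frob_tr m n (A B : 'M[R]_(m, n)) : frob A^T B^T = frob A B.
Proof.
by rewrite !frobE exchange_big; do 2 (apply: eq_bigr => ? _); rewrite !mxE.
Qed.

Lemma frob_mulmxl m n p (A : 'M[R]_(m, n)) (B : 'M[R]_(n, p)) (C : 'M[R]_(m, p)) :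
  frob (A *m B) C = frob B (A^T *m C).
Proof. by rewrite /frob trmx_mul mulmxA. Qed.

Lemma frob_mulmxr m n p (A : 'M[R]_(m, n)) (B : 'M[R]_(n, p)) (C : 'M[R]_(m, p)) :
  frob (A *m B) C = frob A (C *m B^T).
Proof. by rewrite /frob trmx_mul -mulmxA mxtrace_mulC mulmxA. Qed.

Lemma frob_rV n (u v : 'rV[R]_n) : frob u v = \sum_j u 0 j * v 0 j.
Proof. by rewrite frobE big_ord1. Qed.

Lemma frob_rVE n (u v : 'rV[R]_n) : u *m v^T = (frob u v)%:M.
Proof.
apply/matrixP => i j; rewrite !ord1 !mxE eqxx mulr1n frob_rV.
by apply: eq_bigr => k _; rewrite mxE.
Qed.

Lemma frob_row m n (A B : 'M[R]_(m, n)) :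
  frob A B = \sum_i frob (row i A) (row i B).
Proof.
rewrite frobE; apply: eq_bigr => i _; rewrite frob_rV.
by apply: eq_bigr => j _; rewrite !mxE.
Qed.

End FrobeniusAlgebra.

Section Orthogonal.
Context {R : realType}.

Definition orthonormal_rows {m n} (P : 'M[R]_(m, n)) := P *m P^T = 1%:M.

Definition orthogonal {n} (U : 'M[R]_n) := U *m U^T = 1%:M.

Lemma orthogonalC n (U : 'M[R]_n) : orthogonal U -> U^T *m U = 1%:M.
Proof. exact: mulmx1C. Qed.

Lemma orthogonal1 n : orthogonal (1%:M : 'M[R]_n).
Proof. by rewrite /orthogonal trmx1 mulmx1. Qed.

Lemma orthogonal_tr n (U : 'M[R]_n) : orthogonal U -> orthogonal U^T.
Proof. by move=> /orthogonalC oU; rewrite /orthogonal trmxK. Qed.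

Lemma orthogonalM n (U V : 'M[R]_n) :
  orthogonal U -> orthogonal V -> orthogonal (U *m V).
Proof.
move=> oU oV; rewrite /orthogonal trmx_mul mulmxA -(mulmxA U) oV mulmx1.
exact: oU.
Qed.

Lemma orthogonal_unitmx n (U : 'M[R]_n) : orthogonal U -> U \in unitmx.
Proof. by case/mulmx1_unit. Qed.

Lemma frob_conj n (U A B : 'M[R]_n) : orthogonal U ->
  frob (U *m A *m U^T) B = frob A (U^T *m B *m U).
Proof. by move=> oU; rewrite frob_mulmxr frob_mulmxl trmxK mulmxA. Qed.

Lemma frob_conjK n (U A B : 'M[R]_n) : orthogonal U ->
  frob (U *m A *m U^T) (U *m B *m U^T) = frob A B.
Proof.
move=> oU; rewrite frob_conj // !mulmxA (orthogonalC oU) mul1mx.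
by rewrite -mulmxA (orthogonalC oU) mulmx1.
Qed.

Lemma conj_orthogonalK n (U A : 'M[R]_n) : orthogonal U ->
  U^T *m (U *m A *m U^T) *m U = A.
Proof.
move=> oU; rewrite !mulmxA (orthogonalC oU) mul1mx.
by rewrite -mulmxA (orthogonalC oU) mulmx1.
Qed.

(** The Householder reflection that exchanges [delta_mx 0 0] and [v] has [v] as
    its first row. *)
Lemma orthogonal_first_row n (v : 'rV[R]_n.+1) : frob v v = 1 ->
  exists2 Q : 'M[R]_n.+1, orthogonal Q & delta_mx 0 0 *m Q = v.
Proof.
set e := delta_mx 0 0 : 'rV_n.+1 => vv.
have ee : frob e e = 1.
  rewrite frob_rV (bigD1 ord0) //= big1 ?addr0.
    by rewrite !mxE !eqxx mulr1.
  by move=> i i0; rewrite !mxE (negPf i0) andbF mulr0.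
have [->|ve] := eqVneq v e.
  by exists 1%:M; [exact: orthogonal1|rewrite mulmx1].
pose w := v - e; have w0 : 0 < frob w w by apply: frob_gt0; rewrite subr_eq0.
pose c := 2 / frob w w.
pose Q : 'M[R]_n.+1 := 1%:M - c *: (w^T *m w).
have QT : Q^T = Q by rewrite /Q linearB /= trmx1 linearZ /= trmx_mul trmxK.
have mw (x : 'rV[R]_n.+1) : x *m Q = x - (c * frob x w) *: w.
  rewrite /Q mulmxBr mulmx1 -scalemxAr mulmxA frob_rVE mul_scalar_mx.
  by rewrite scalerA.
exists Q.
  rewrite /orthogonal QT; apply/row_matrixP => i; rewrite row_mul mw.
  rewrite rowE row1 mw frobBl frobZl; set x := delta_mx 0 i.
  have w1 : frob w w != 0 by rewrite gt_eqF.
  have key : c * frob x w + c * (frob x w - c * frob x w * frob w w) = 0.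
    by rewrite /c; field.
  by rewrite -addrA -opprD -scalerDl key scale0r subr0.
rewrite mw (_ : c * _ = -1) ?scaleN1r ?opprK ?/w; first by rewrite addrC subrK.
have ew : frob w w = 2 - 2 * frob e v.
  by rewrite /w frobBl !frobBr vv ee (frobC v e); ring.
have ew' : frob e w = frob e v - 1 by rewrite /w frobBr ee.
have w1 : frob w w != 0 by rewrite gt_eqF.
by rewrite /c ew'; apply: (mulIf w1); rewrite mulrAC divfK // ew; ring.
Qed.

End Orthogonal.

(** * Limits of matrices and the spectral theorem *)

Section MatrixLimits.
Context {R : realType} {T : Type} {F : set_system T} {FF : Filter F}.

Lemma cvg_mxP m n (f : T -> 'M[R]_(m, n)) (A : 'M[R]_(m, n)) :
  f x @[x --> F] --> A <-> forall i j, f x i j @[x --> F] --> A i j.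
Proof.
split=> [fA i j|fA].
  exact: (cvg_comp f (fun M : 'M[R]_(m, n) => M i j) fA
                   (@coord_continuous _ _ _ i j A)).
apply/cvg_ballP => e e0.
have : \forall x \near F, forall ij : 'I_m * 'I_n,
    ball (A ij.1 ij.2) e (f x ij.1 ij.2).
  by apply: filter_forall => -[i j]; exact: (cvg_ball (fA i j)).
by apply: filterS => x fx; split=> // i j; exact: (fx (i, j)).
Qed.

Lemma cvg_sumr (I : Type) (r : seq I) (P : pred I) (f : I -> T -> R)
    (a : I -> R) :
  (forall i, P i -> f i x @[x --> F] --> a i) ->
  (\sum_(i <- r | P i) f i x) @[x --> F] --> \sum_(i <- r | P i) a i.
Proof.
move=> fa; elim: r => [|i r IH].
  by rewrite big_nil; under eq_fun do rewrite big_nil; exact: cvg_cst.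
rewrite big_cons; under eq_fun do rewrite big_cons.
by case: ifP => // Pi; apply: cvgD => //; exact: fa.
Qed.

Lemma cvg_mulmx m n p (f : T -> 'M[R]_(m, n)) (g : T -> 'M[R]_(n, p))
    (A : 'M[R]_(m, n)) (B : 'M[R]_(n, p)) :
  f x @[x --> F] --> A -> g x @[x --> F] --> B ->
  (f x *m g x) @[x --> F] --> A *m B.
Proof.
move=> /cvg_mxP fA /cvg_mxP gB; apply/cvg_mxP => i j.
rewrite mxE; under eq_fun do rewrite mxE.
by apply: cvg_sumr => k _; apply: cvgM.
Qed.

Lemma cvg_frob m n (f g : T -> 'M[R]_(m, n)) (A B : 'M[R]_(m, n)) :
  f x @[x --> F] --> A -> g x @[x --> F] --> B ->
  frob (f x) (g x) @[x --> F] --> frob A B.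
Proof.
move=> /cvg_mxP fA /cvg_mxP gB.
rewrite frobE; under eq_fun do rewrite frobE.
by do 2 (apply: cvg_sumr => ? _); apply: cvgM.
Qed.

Lemma cvg_frob0P m n (f : T -> 'M[R]_(m, n)) (A : 'M[R]_(m, n)) :
  f x @[x --> F] --> A <-> frob (f x - A) (f x - A) @[x --> F] --> (0 : R).
Proof.
split=> [fA|f0].
  rewrite -(frob0r (0 : 'M[R]_(m, n))) -(subrr A).
  by apply: cvg_frob; apply: cvgB => //; exact: cvg_cst.
apply/cvg_mxP => i j; apply/cvgrPdist_lt => e e0.
have e2 : 0 < e ^+ 2 by rewrite exprn_gt0.
apply: filterS (cvgr_lt 0 f0 _ e2) => x fx.
rewrite -(@ltr_pXn2r _ 2) ?nnegrE ?(ltW e0) ?normr_ge0 //.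
rewrite real_normK ?num_real //; apply: le_lt_trans fx.
apply: le_trans (frob_coord_le (f x - A) i j).
by rewrite !mxE -sqrrN opprB.
Qed.

End MatrixLimits.

Section Spectral.
Context {R : realType}.

(** A maximizer of the Rayleigh quotient on the unit sphere is an eigenvector:
    its first variation vanishes orthogonally to it. *)
Lemma symmetric_eigenvector n (A : 'M[R]_n.+1) : A^T = A ->
  exists (v : 'rV[R]_n.+1) (l : R), frob v v = 1 /\ v *m A = l *: v.
Proof.
move=> As; pose S := [set v : 'rV[R]_n.+1 | frob v v = 1].
pose f (v : 'rV[R]_n.+1) := frob (v *m A) v.
have frobc : continuous (fun v : 'rV[R]_n.+1 => frob v v).
  by move=> v; apply: (@cvg_frob _ _ (nbhs v) _ _ _ id id); exact: cvg_id.
have fc : continuous f.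
  move=> v; apply: (@cvg_frob _ _ (nbhs v) _ _ _ (mulmx^~ A) id) cvg_id.
  by apply: (@cvg_mulmx _ _ (nbhs v) _ _ _ _ id (fun=> A) v A);
    [exact: cvg_id|exact: cvg_cst].
have S0 : S !=set0.
  exists (delta_mx 0 0); rewrite /S /= frob_rV (bigD1 ord0) //= big1 ?addr0.
    by rewrite !mxE !eqxx mulr1.
  by move=> i i0; rewrite !mxE (negPf i0) andbF mulr0.
have Sc : compact S.
  apply: bounded_closed_compact.
    exists 1; split=> // M M1 v; rewrite /S /= => Sv; apply: le_trans (ltW M1).
    rewrite /Num.norm /= mx_normrE; apply/bigmax_leP; split=> // -[i j] _ /=.
    rewrite -(@ler_pXn2r _ 2) ?nnegrE // expr1n real_normK ?num_real // -Sv.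
    exact: frob_coord_le.
  rewrite (_ : S = (fun v : 'rV[R]_n.+1 => frob v v) @^-1` [set 1]) //.
  by apply: preimage_closed; [move=> x _; exact: frobc|exact: closed_eq].
have [v /set_mem Sv vmax] := compact_EVT_max S0 Sc (continuous_subspaceT fc).
pose l := f v; exists v, l; split=> //.
have vv : frob v v = 1 := Sv.
have maxl w : f w <= l * frob w w.
  have [->|w0] := eqVneq w 0; first by rewrite /f mul0mx !frob0r mulr0.
  have ww : 0 < frob w w by exact: frob_gt0.
  have wS : (Num.sqrt (frob w w))^-1 *: w \in S.
    apply/mem_set; rewrite /S /= frobZl frobZr mulrA -invfM -expr2.
    by rewrite sqr_sqrtr ?(ltW ww) // mulVf ?gt_eqF.
  have := vmax _ wS.
  rewrite /f -scalemxAl frobZl frobZr mulrA -invfM -expr2 sqr_sqrtr ?(ltW ww) //.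
  by rewrite mulrC ler_pdivrMr.
have [r rE] : exists r, r = v *m A - l *: v by exists (v *m A - l *: v).
have vr : frob v r = 0 by rewrite rE frobBr frobZr vv mulr1 frobC subrr.
have rA : frob (v *m A) r = frob r r.
  by rewrite {2}rE frobBl frobZl vr mulr0 subr0.
suff r0 : r = 0 by apply/eqP; rewrite -subr_eq0 -rE r0.
apply: contrapT => /eqP /frob_gt0 rr.
pose c := f r - l * frob r r.
have ub s : 2 * s * frob r r + s ^+ 2 * c <= 0.
  have := maxl (v + s *: r); rewrite /f mulmxDl -scalemxAl.
  rewrite !frobDl !frobDr !frobZl !frobZr (frobC r v) vr rA.
  have -> : frob (r *m A) v = frob r r.
    by rewrite frob_mulmxr As frobC rA.
  rewrite -/(f v) -/(f r) -/l vv /c.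
  by move: (f r) (frob r r) => x y; lra.
have cn : c < 0 \/ 0 <= c by case: (ltP c 0); [left|right].
case: cn => [c0|c0].
  have := ub (frob r r / - c).
  have : 0 < frob r r / - c * frob r r.
    by rewrite mulr_gt0 // divr_gt0 // oppr_gt0.
  have -> : (frob r r / - c) ^+ 2 * c = - (frob r r / - c * frob r r).
    by field; rewrite lt_eqF.
  lra.
by have := ub 1; rewrite expr1n mul1r mulr1; lra.
Qed.

(** Deflation: in an orthonormal basis that starts with an eigenvector, the
    matrix is block diagonal. *)
Theorem symmetric_spectral n (A : 'M[R]_n) : A^T = A ->
  exists (U : 'M[R]_n) (v : 'rV[R]_n),
    orthogonal U /\ A = U *m diag_mx v *m U^T.
Proof.
elim: n A => [|n IH] A As.
  exists 1%:M, 0; split; first exact: orthogonal1.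
  by apply/matrixP => -[].
have [v [l [vv vA]]] := symmetric_eigenvector As.
have [Q oQ eQ] := orthogonal_first_row vv.
have [B BE] : exists B : 'M[R]_(1 + n), B = Q *m A *m Q^T by eexists.
have Bs : B^T = B by rewrite BE !trmx_mul trmxK As mulmxA.
have eB : (delta_mx 0 0 : 'rV[R]_n.+1) *m B = l *: delta_mx 0 0.
  by rewrite BE !mulmxA eQ vA -scalemxAl -eQ -mulmxA oQ mulmx1.
(* Symmetry makes the first column vanish along with the first row. *)
have B0 j : B 0 j = l * (j == 0)%:R.
  by have /rowP/(_ j) := eB; rewrite -rowE !mxE eqxx.
have [U' [v' [oU' BU']]] : exists (U : 'M[R]_n) (v : 'rV[R]_n),
    orthogonal U /\ drsubmx B = U *m diag_mx v *m U^T.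
  by apply: IH; rewrite trmx_drsub Bs.
pose W : 'M[R]_(1 + n) := block_mx 1%:M 0 0 U'.
have oW : orthogonal W.
  rewrite /orthogonal /W tr_block_mx !trmx0 trmx1 mulmx_block.
  by rewrite !mulmx0 !mul0mx !mulmx1 !addr0 add0r oU' -scalar_mx_block.
have l0 : lshift n (0 : 'I_1) = 0 :> 'I_n.+1 by exact: val_inj.
have BW : B = W *m diag_mx (row_mx l%:M v') *m W^T.
  rewrite /W diag_mx_row tr_block_mx !trmx0 trmx1 !mulmx_block.
  rewrite !mulmx0 !mul0mx !mulmx1 !mul1mx !addr0 !add0r mul0mx -BU'.
  rewrite -[LHS]submxK; congr block_mx.
  - by apply/matrixP => i j; rewrite !ord1 !mxE l0 B0 !eqxx mulr1 mulr1n.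
  - by apply/matrixP => i j; rewrite !ord1 !mxE l0 B0 mulr0.
  - by apply/matrixP => i j; rewrite !ord1 !mxE -Bs mxE l0 B0 mulr0.
exists (Q^T *m W), (row_mx l%:M v'); split.
  by apply: orthogonalM => //; exact: orthogonal_tr.
rewrite trmx_mul trmxK -{1}(conj_orthogonalK A oQ).
by rewrite -BE BW !mulmxA.
Qed.

Definition nonincreasing n (v : 'rV[R]_n) :=
  forall i j : 'I_n, (i <= j)%N -> v 0 j <= v 0 i.

Lemma sorting_perm n (v : 'rV[R]_n) : exists s : 'S_n, nonincreasing (col_perm s v).
Proof.
pose t := [tuple v 0 i | i < n].
have ge_total : total (fun x y : R => y <= x) by move=> x y; exact: le_total.
have ge_trans : transitive (fun x y : R => y <= x).
  by move=> x y z xy yz; exact: le_trans yz xy.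
have pt : perm_eq (sort_tuple (fun x y => y <= x) t) t.
  by rewrite /= perm_sort.
have [s ts] := tuple_permP pt.
exists s => i j; rewrite leq_eqVlt => /predU1P[/val_inj -> //|ij].
have E (k : 'I_n) : col_perm s v 0 k = nth 0 (sort (fun x y => y <= x) t) k.
  rewrite mxE ts; have kn := ltn_ord k.
  rewrite (nth_map k) ?size_enum_ord // nth_ord_enum.
  by rewrite tnth_mktuple.
rewrite !E; apply: (sorted_ltn_nth ge_trans); rewrite ?inE ?size_sort ?size_tuple //.
exact: sort_sorted.
Qed.

Lemma col_perm_diag n (U : 'M[R]_n) (v : 'rV[R]_n) (s : 'S_n) :
  col_perm s U *m diag_mx (col_perm s v) *m (col_perm s U)^T =
  U *m diag_mx v *m U^T.
Proof.
apply/matrixP => i j; rewrite !mul_mx_diag !mxE.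
rewrite [RHS](reindex_inj (@perm_inj _ s)) /=.
by apply: eq_bigr => k _; rewrite !mxE.
Qed.

Lemma orthogonal_col_perm n (U : 'M[R]_n) (s : 'S_n) :
  orthogonal U -> orthogonal (col_perm s U).
Proof.
rewrite /orthogonal => oU; have := col_perm_diag U (const_mx 1) s.
have -> : col_perm s (const_mx 1 : 'rV[R]_n) = const_mx 1.
  by apply/rowP => i; rewrite !mxE.
by rewrite diag_const_mx !mulmx1 oU.
Qed.

Lemma sorted_spectral n (A : 'M[R]_n) : A^T = A ->
  exists (U : 'M[R]_n) (v : 'rV[R]_n),
    [/\ orthogonal U, nonincreasing v & A = U *m diag_mx v *m U^T].
Proof.
move=> /symmetric_spectral[U [v [oU ->]]]; have [s sv] := sorting_perm v.
exists (col_perm s U), (col_perm s v); split=> //.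
  exact: orthogonal_col_perm.
by rewrite col_perm_diag.
Qed.

End Spectral.

(** * Interlacing and trace inequalities *)

Section Majorization.
Context {R : realType}.

Lemma frob_mul_diag m n (x y : 'M[R]_(m, n)) (b : 'rV[R]_n) :
  frob (x *m diag_mx b) y = \sum_i \sum_j b 0 j * (x i j * y i j).
Proof.
rewrite frobE; do 2 (apply: eq_bigr => ? _).
by rewrite mul_mx_diag !mxE; ring.
Qed.

Lemma frob_diag n (z : 'rV[R]_n) (M : 'M[R]_n) :
  frob (diag_mx z) M = \sum_i z 0 i * M i i.
Proof.
rewrite frobE; apply: eq_bigr => i _; rewrite (bigD1 i) //= big1 ?addr0.
  by rewrite mxE eqxx mulr1n.
by move=> j ji; rewrite mxE eq_sym (negPf ji) mulr0n mul0r.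
Qed.

Lemma frob_diag_diag n (a b : 'rV[R]_n) :
  frob (diag_mx a) (diag_mx b) = frob a b.
Proof.
by rewrite frob_diag frob_rV; apply: eq_bigr => i _; rewrite mxE eqxx mulr1n.
Qed.

Lemma trace_conj_diag n (Q : 'M[R]_n) (b : 'rV[R]_n) : orthogonal Q ->
  \tr (Q *m diag_mx b *m Q^T) = \sum_i b 0 i.
Proof.
by move=> oQ; rewrite mxtrace_mulC mulmxA orthogonalC // mul1mx mxtrace_diag.
Qed.

Lemma det_conj_diag n (Q : 'M[R]_n) (b : 'rV[R]_n) : orthogonal Q ->
  \det (Q *m diag_mx b *m Q^T) = \prod_i b 0 i.
Proof.
move=> oQ; rewrite !det_mulmx mulrAC -det_mulmx oQ det1 mul1r.
exact: det_diag.
Qed.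

(** A dimension count: some combination [y] of the rows [0..i] of [M] vanishes on
    the coordinates [0..i-1], and its Rayleigh quotient is both at least [b_i] and
    at most [nu_i]. *)
Lemma orthonormal_interlacing k d (M : 'M[R]_(k, d)) (nu : 'rV[R]_d)
    (b : 'rV[R]_k) (kd : (k <= d)%N) :
  orthonormal_rows M -> nonincreasing nu -> nonincreasing b ->
  M *m diag_mx nu *m M^T = diag_mx b ->
  forall i, b 0 i <= nu 0 (widen_ord kd i).
Proof.
move=> oM nus bs Mb i.
have ik : (i.+1 <= k)%N by [].
have id : (i <= d)%N by apply: leq_trans kd; exact: ltnW.
pose f := widen_ord ik.
pose N := mxsub f (widen_ord id) M.
(* Rows [0..i] of [M], seen on the columns [0..i-1], are linearly dependent. *)
have : kermx N != 0.
  rewrite kermx_eq0 -row_leq_rank -ltnNge ltnS; exact: rank_leq_col.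
case/rowV0Pn => x' /sub_kermxP x'N x'0.
pose x := x' *m rowsub f 1%:M; pose y := x *m M.
have xf a : x 0 (f a) = x' 0 a.
  rewrite mxE (bigD1 a) //= big1 ?addr0 ?mxE ?eqxx ?mulr1 //.
  move=> c ca; rewrite !mxE (_ : (f c == f a) = false) ?mulr0 //.
  by apply/negbTE; apply: contra ca => /eqP/(congr1 val)/= ca; apply/eqP/val_inj.
have xi (a : 'I_k) : (i < a)%N -> x 0 a = 0.
  move=> ia; rewrite mxE big1 // => c _; rewrite !mxE.
  rewrite (_ : (f c == a) = false) ?mulr0 //; apply/negbTE/negP => /eqP ca.
  by move: ia; rewrite -ca /= ltnNge -ltnS ltn_ord.
have yj (j : 'I_d) : (j < i)%N -> y 0 j = 0.
  move=> ji; have /rowP/(_ (Ordinal ji)) := x'N; rewrite [RHS]mxE => <-.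
  rewrite /y /x -mulmxA mul_rowsub_mx mul1mx !mxE.
  apply: eq_bigr => c _; rewrite !mxE; congr (_ * M _ _).
  exact: val_inj.
have xx : 0 < frob x x.
  apply: frob_gt0; apply: contra x'0 => /eqP x0; apply/eqP/rowP => a.
  by rewrite -xf x0 !mxE.
have yy : frob y y = frob x x by rewrite /y frob_mulmxr -mulmxA oM mulmx1.
have yb : frob (y *m diag_mx nu) y = frob (x *m diag_mx b) x.
  by rewrite -Mb /y -!mulmxA frob_mulmxr [RHS]frob_mulmxr !trmx_mul !tr_diag_mx
     trmxK !mulmxA.
rewrite -(ler_pM2r xx) -{2}yy; apply: (@le_trans _ _ (frob (x *m diag_mx b) x)).
  rewrite frob_mul_diag frobE !big_ord1 mulr_sumr; apply: ler_sum => a _.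
  have [ia|ai] := ltnP i a; first by rewrite xi // !mul0r !mulr0.
  by rewrite ler_wpM2r ?bs // -expr2 sqr_ge0.
rewrite -yb frob_mul_diag frobE !big_ord1 mulr_sumr; apply: ler_sum => j _.
have [ji|ij] := ltnP j i; first by rewrite yj // !mul0r !mulr0.
by rewrite ler_wpM2r ?nus // -expr2 sqr_ge0.
Qed.

(** The previous lemma, in eigenbases of [B] and of its compression to the span
    of the rows of [P]. *)
Lemma cauchy_interlacing k d (B W : 'M[R]_d) (nu : 'rV[R]_d)
    (P : 'M[R]_(k, d)) (Q : 'M[R]_k) (b : 'rV[R]_k) (kd : (k <= d)%N) :
  orthogonal W -> nonincreasing nu -> B = W *m diag_mx nu *m W^T ->
  orthonormal_rows P ->
  orthogonal Q -> nonincreasing b -> P *m B *m P^T = Q *m diag_mx b *m Q^T ->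
  forall i, b 0 i <= nu 0 (widen_ord kd i).
Proof.
move=> oW nus BW oP oQ bs PB.
apply: (@orthonormal_interlacing _ _ (Q^T *m P *m W)) => //.
  rewrite /orthonormal_rows !trmx_mul trmxK !mulmxA.
  rewrite -(mulmxA _ W) oW mulmx1 -(mulmxA _ P) oP mulmx1.
  exact: orthogonalC.
rewrite -[RHS](conj_orthogonalK _ oQ) -PB BW !trmx_mul trmxK.
by rewrite !mulmxA.
Qed.

Definition leading_rows k d (kd : (k <= d)%N) : 'M[R]_(k, d) :=
  rowsub (widen_ord kd) 1%:M.

Lemma leading_rows_orthonormal k d (kd : (k <= d)%N) :
  orthonormal_rows (leading_rows kd).
Proof.
rewrite /orthonormal_rows /leading_rows trmx_mxsub trmx1 mul_rowsub_mx mul1mx.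
by apply/matrixP => i j; rewrite !mxE.
Qed.

Lemma leading_rows_conj k d (kd : (k <= d)%N) (B : 'M[R]_d) i j :
  (leading_rows kd *m B *m (leading_rows kd)^T) i j =
  B (widen_ord kd i) (widen_ord kd j).
Proof.
rewrite /leading_rows trmx_mxsub trmx1 mul_rowsub_mx mul1mx.
by rewrite mulmx_colsub mulmx1 !mxE.
Qed.

Lemma leading_rows_symmetric k d (kd : (k <= d)%N) (B : 'M[R]_d) : B^T = B ->
  (leading_rows kd *m B *m (leading_rows kd)^T)^T =
  leading_rows kd *m B *m (leading_rows kd)^T.
Proof. by move=> Bs; rewrite !trmx_mul trmxK Bs mulmxA. Qed.

Lemma symmetric_conj_diag n (U : 'M[R]_n) (v : 'rV[R]_n) :
  (U *m diag_mx v *m U^T)^T = U *m diag_mx v *m U^T.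
Proof. by rewrite !trmx_mul trmxK tr_diag_mx mulmxA. Qed.

Lemma abel_le d (z c : 'I_d.+1 -> R) :
  (forall i j : 'I_d.+1, (i <= j)%N -> z j <= z i) ->
  (forall k (kd : (k <= d.+1)%N), 0 <= \sum_(i < k) c (widen_ord kd i)) ->
  z ord_max * \sum_i c i <= \sum_i z i * c i.
Proof.
elim: d z c => [|d IH] z c zs cs.
  by rewrite !big_ord1 (_ : ord_max = 0) //; exact: val_inj.
rewrite big_ord_recr [leRHS]big_ord_recr /= mulrDr lerD2r.
set w := widen_ord _.
apply: (@le_trans _ _ (z (w ord_max) * \sum_i c (w i))).
  apply: ler_wpM2r; last by apply: zs; exact: leqnSn.
  exact: (cs d.+1 (leqnSn _)).
apply: (IH (z \o w) (c \o w)) => [i j ij|k kd]; first exact: zs.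
have := cs k (leq_trans kd (leqnSn _)); congr (_ <= _).
by apply: eq_bigr => i _ /=; apply: (congr1 c); exact: val_inj.
Qed.

(** Summation by parts: nonnegative partial sums of [c] with a zero total are
    what makes a sum against a nonincreasing [z] nonnegative. Majorization enters
    every inequality below through this form. *)
Lemma abel_ge0 d (z c : 'I_d -> R) :
  (forall i j : 'I_d, (i <= j)%N -> z j <= z i) ->
  (forall k (kd : (k <= d)%N), 0 <= \sum_(i < k) c (widen_ord kd i)) ->
  \sum_i c i = 0 -> 0 <= \sum_i z i * c i.
Proof.
case: d z c => [|d] z c zs cs c0; first by rewrite big_ord0.
by have := abel_le zs cs; rewrite c0 mulr0.
Qed.

(** Von Neumann's trace inequality holds because the diagonal of a symmetric
    matrix, in any orthonormal basis, is majorized by its spectrum: its leading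
    partial sums are traces of compressions. *)
Lemma von_neumann n (A B U V : 'M[R]_n) (a b : 'rV[R]_n) :
  orthogonal U -> orthogonal V -> nonincreasing a -> nonincreasing b ->
  A = U *m diag_mx a *m U^T -> B = V *m diag_mx b *m V^T ->
  frob A B <= frob a b.
Proof.
move=> oU oV as_ bs -> BV; rewrite frob_conj // frob_diag frob_rV -subr_ge0.
set C := U^T *m B *m U.
have CE : C = (U^T *m V) *m diag_mx b *m (U^T *m V)^T.
  by rewrite /C BV trmx_mul trmxK !mulmxA.
have oUV : orthogonal (U^T *m V).
  by apply: orthogonalM => //; exact: orthogonal_tr.
rewrite -sumrB; under eq_bigr do rewrite -mulrBr.
apply: (@abel_ge0 _ (fun i => a 0 i) (fun i => b 0 i - C i i)) => //.
  move=> k kd; rewrite sumrB subr_ge0.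
  have Cs : C^T = C by rewrite CE symmetric_conj_diag.
  have [Q [v [oQ vs PC]]] := sorted_spectral (leading_rows_symmetric kd Cs).
  apply: (@le_trans _ _ (\sum_i v 0 i)).
    rewrite -(trace_conj_diag v oQ) -PC.
    by apply: ler_sum => i _; rewrite leading_rows_conj.
  apply: ler_sum => i _.
  exact: (cauchy_interlacing kd oUV bs CE (leading_rows_orthonormal kd) oQ vs PC).
by rewrite sumrB -(trace_conj_diag b oUV) -CE subrr.
Qed.

(** Diagonalizing [A + B] does it: the spectrum of the sum has to be [a + b],
    and each of the two trace inequalities against it is then an equality. *)
Lemma von_neumann_eq n (A B U V : 'M[R]_n) (a b : 'rV[R]_n) :
  orthogonal U -> orthogonal V -> nonincreasing a -> nonincreasing b ->
  A = U *m diag_mx a *m U^T -> B = V *m diag_mx b *m V^T ->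
  frob a b <= frob A B ->
  exists W, [/\ orthogonal W, A = W *m diag_mx a *m W^T
                            & B = W *m diag_mx b *m W^T].
Proof.
move=> oU oV as_ bs AU BV abAB.
have ABE : frob A B = frob a b.
  by apply/eqP; rewrite eq_le abAB andbT (von_neumann oU oV).
have AA : frob A A = frob a a by rewrite AU frob_conjK // frob_diag_diag.
have BB : frob B B = frob b b by rewrite BV frob_conjK // frob_diag_diag.
have ABs : (A + B)^T = A + B.
  by rewrite linearD /= AU BV !symmetric_conj_diag.
have [W [w [oW ws ABW]]] := sorted_spectral ABs.
have Aw : frob A (A + B) <= frob a w by exact: (von_neumann oU oW as_ ws AU ABW).
have Bw : frob B (A + B) <= frob b w by exact: (von_neumann oV oW bs ws BV ABW).
have ww : frob w w = frob (A + B) (A + B).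
  by rewrite {1 2}ABW frob_conjK // frob_diag_diag.
have wE : w = a + b.
  apply/eqP; rewrite -subr_eq0; apply/eqP/frob_eq0/eqP.
  rewrite eq_le frob_ge0 andbT.
  move: Aw Bw ww; rewrite !frobBl !frobBr !frobDl !frobDr.
  rewrite AA BB (frobC B A) ABE (frobC b a) (frobC w a) (frobC w b); lra.
pose A' := W *m diag_mx a *m W^T; pose B' := W *m diag_mx b *m W^T.
have AB' : A' + B' = A + B.
  by rewrite ABW wE raddfD /= mulmxDr mulmxDl.
have AA' : frob A A' <= frob a a by exact: (von_neumann oU oW as_ _ AU erefl).
have AB'' : frob A B' <= frob a b by exact: (von_neumann oU oW as_ _ AU erefl).
have AE : A = A'.
  apply/eqP; rewrite -subr_eq0; apply/eqP/frob_eq0/eqP.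
  rewrite eq_le frob_ge0 andbT.
  have : frob A (A' + B') = frob A (A + B) by rewrite AB'.
  rewrite !frobBl !frobBr !frobDr (frobC A' A).
  have -> : frob A' A' = frob a a by rewrite frob_conjK // frob_diag_diag.
  lra.
exists W; split => //; rewrite -/B'.
by apply: (addrI A); rewrite -AB' -AE.
Qed.

End Majorization.

(** * Functional calculus and positive definite matrices *)

Section FunctionalCalculus.
Context {R : realType} {n : nat}.
Implicit Types (A B U V P Q : 'M[R]_n) (a b v x y : 'rV[R]_n).

(** The weights [(U^T *m V) i j ^+ 2] do not depend on the eigenvalues, so that
    the matrices [f A - g B] can be compared entry by entry for all [f], [g]. *)
Lemma frob_spectral_diff U V x y : orthogonal U -> orthogonal V ->
  frob (U *m diag_mx x *m U^T - V *m diag_mx y *m V^T)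
       (U *m diag_mx x *m U^T - V *m diag_mx y *m V^T) =
  \sum_i \sum_j ((U^T *m V) i j) ^+ 2 * (x 0 i - y 0 j) ^+ 2.
Proof.
move=> oU oV; set O := U^T *m V.
pose M := diag_mx x *m O - O *m diag_mx y.
have -> : U *m diag_mx x *m U^T - V *m diag_mx y *m V^T = U *m M *m V^T.
  rewrite /M /O mulmxBr mulmxBl !mulmxA; congr (_ - _).
    by rewrite -[in RHS](mulmxA _ V) oV mulmx1.
  by rewrite oU mul1mx.
have -> : frob (U *m M *m V^T) (U *m M *m V^T) = frob M M.
  rewrite frob_mulmxr frob_mulmxl trmxK !mulmxA orthogonalC // mul1mx.
  by rewrite -mulmxA orthogonalC // mulmx1.
rewrite frobE; do 2 (apply: eq_bigr => ? _).
by rewrite /M mul_diag_mx mul_mx_diag !mxE; ring.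
Qed.

(** Where a weight [(U^T *m V) i j ^+ 2] does not vanish, the eigenvalues [v_i]
    and [w_j] of two diagonalizations of the same matrix agree: hence so do their
    images, and the functional calculus does not depend on the basis. *)
Lemma mxfunE (f : R -> R) U v : orthogonal U ->
  mxfun f (U *m diag_mx v *m U^T) = U *m diag_mx (map_mx f v) *m U^T.
Proof.
move=> oU; rewrite /mxfun; set S := [set B | _].
have : S (xget 0 S) by apply: xgetPex; eexists; exists U, v; split.
move: (xget 0 S) => B [V [w [oV AE ->]]].
apply/eqP; rewrite eq_sym -subr_eq0; apply/eqP/frob_eq0.
have /eqP := frob_spectral_diff v w oU oV; rewrite AE subrr frob0l eq_sym.
rewrite frob_spectral_diff // psumr_eq0; last first.
  by move=> i _; apply: sumr_ge0 => j _; rewrite mulr_ge0 ?sqr_ge0.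
move=> /allP z; apply: big1 => i _; apply: big1 => j _.
rewrite [map_mx f v 0 i]mxE [map_mx f w 0 j]mxE.
have := z i (mem_index_enum _); rewrite psumr_eq0; last first.
  by move=> k _; rewrite mulr_ge0 ?sqr_ge0.
move=> /allP/(_ j (mem_index_enum _)); rewrite /= mulf_eq0 => /orP[/eqP->|].
  by rewrite mul0r.
by rewrite sqrf_eq0 subr_eq0 => /eqP ->; rewrite subrr expr0n mulr0.
Qed.

(** The functional calculus inherits the Lipschitz constant of [f] on a set that
    contains both spectra, since the weights are the same on both sides. *)
Lemma mxfun_lipschitz (f : R -> R) (I : R -> Prop) (K : R) U V a b :
  (forall s t : R, I s -> I t -> (f s - f t) ^+ 2 <= K * (s - t) ^+ 2) ->
  orthogonal U -> orthogonal V -> (forall i, I (a 0 i)) -> (forall i, I (b 0 i)) ->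
  frob (mxfun f (U *m diag_mx a *m U^T) - mxfun f (V *m diag_mx b *m V^T))
       (mxfun f (U *m diag_mx a *m U^T) - mxfun f (V *m diag_mx b *m V^T)) <=
  K * frob (U *m diag_mx a *m U^T - V *m diag_mx b *m V^T)
           (U *m diag_mx a *m U^T - V *m diag_mx b *m V^T).
Proof.
move=> fK oU oV Ia Ib; rewrite !mxfunE // !frob_spectral_diff //.
rewrite mulr_sumr; apply: ler_sum => i _; rewrite mulr_sumr.
apply: ler_sum => j _; rewrite [map_mx f a 0 i]mxE [map_mx f b 0 j]mxE.
rewrite [leRHS]mulrCA ler_wpM2l ?sqr_ge0 //.
exact: fK.
Qed.

Lemma char_poly_conj P Q A : P *m Q = 1%:M ->
  char_poly (P *m A *m Q) = char_poly A.
Proof.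
move=> PQ; rewrite /char_poly.
have PQ' : map_mx polyC P *m map_mx polyC Q = 1%:M.
  by rewrite -map_mxM PQ map_mx1.
have -> : char_poly_mx (P *m A *m Q) =
    map_mx polyC P *m char_poly_mx A *m map_mx polyC Q.
  rewrite /char_poly_mx mulmxBr mulmxBl !map_mxM; congr (_ - _).
  by rewrite mul_mx_scalar -scalemxAl PQ' scalemx1.
by rewrite !det_mulmx mulrAC -det_mulmx PQ' det1 mul1r.
Qed.

Lemma char_poly_conj_diag U v : orthogonal U ->
  char_poly (U *m diag_mx v *m U^T) = \prod_(i < n) ('X - (v 0 i)%:P).
Proof.
move=> oU; rewrite char_poly_conj // char_poly_trig ?diag_mx_is_trig //.
by apply: eq_bigr => i _; rewrite mxE eqxx mulr1n.
Qed.

(** Unique factorization of the characteristic polynomial: it is only through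
    this lemma that the unspecified order of [eigvals] is handled. *)
Lemma eigvals_perm A v : char_poly A = \prod_(i < n) ('X - (v 0 i)%:P) ->
  exists s : 'S_n, eigvals A = col_perm s v.
Proof.
move=> Av; rewrite /eigvals; set S := [set w | _].
have : S (xget 0 S) by apply: (xgetPex 0 (P := S)); exists v.
move: (xget 0 S) => w; rewrite /S /= Av => vw.
pose tv := [tuple v 0 i | i < n]; pose tw := [tuple w 0 i | i < n].
have : perm_eq tw tv.
  by apply: prod_XsubC_eq; rewrite !big_tuple; under eq_bigr do rewrite tnth_mktuple;
    rewrite -vw; apply: eq_bigr => i _; rewrite tnth_mktuple.
move/tuple_permP => [s ws]; exists s; apply/rowP => i; rewrite mxE.
have kn := ltn_ord i.
have : nth 0 tw i = nth 0 [seq tnth tv (s j) | j <- enum 'I_n] i by rewrite ws.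
by rewrite -(tnth_nth 0) (nth_map i) ?size_enum_ord // nth_ord_enum !tnth_mktuple.
Qed.

Lemma symmetric_fun_eigvals (phi : 'rV[R]_n -> R) (f : R -> R) A v :
  permutation_invariant phi ->
  char_poly A = \prod_(i < n) ('X - (v 0 i)%:P) ->
  phi (map_mx f (eigvals A)) = phi (map_mx f v).
Proof. by move=> ps /eigvals_perm[s ->]; rewrite map_col_perm ps. Qed.

Lemma symmetric_eigvals (phi : 'rV[R]_n -> R) U v :
  permutation_invariant phi -> orthogonal U ->
  phi (eigvals (U *m diag_mx v *m U^T)) = phi v.
Proof.
move=> ps oU; have [s ->] := eigvals_perm (char_poly_conj_diag v oU).
exact: ps.
Qed.

End FunctionalCalculus.

Section PositiveDefinite.
Context {R : realType} {n : nat}.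
Implicit Types (A B G H K P Q U X : 'M[R]_n) (v : 'rV[R]_n).

Definition mxexp : 'M[R]_n -> 'M[R]_n := mxfun expR.

Lemma quadE A v : (v *m A *m v^T) 0 0 = frob (v *m A) v.
Proof. by rewrite frob_rVE mxE mulr1n. Qed.

Lemma spd_conj_diag U v : orthogonal U -> (forall i, 0 < v 0 i) ->
  spd (U *m diag_mx v *m U^T).
Proof.
move=> oU v0; split; first exact: symmetric_conj_diag.
move=> x x0; rewrite quadE mulmxA frob_mulmxr trmxK mulmxA.
have : x *m U != 0.
  by apply: contra x0 => /eqP xU; rewrite -[x]mulmx1 -oU mulmxA xU mul0mx.
move: (x *m U) => y y0; rewrite frob_mul_diag big_ord1.
have /rV0Pn[j yj] := y0; rewrite (bigD1 j) //= ltr_wpDr //.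
  by apply: sumr_ge0 => i _; rewrite mulr_ge0 ?(ltW (v0 i)) // -expr2 sqr_ge0.
by rewrite mulr_gt0 // -expr2 exprn_even_gt0.
Qed.

Lemma spd_spectral A : spd A -> exists U v,
  [/\ orthogonal U, nonincreasing v, (forall i, 0 < v 0 i)
    & A = U *m diag_mx v *m U^T].
Proof.
case=> As Apos; have [U [v [oU vs AU]]] := sorted_spectral As.
exists U, v; split=> // i.
have d0 : (delta_mx 0 i : 'rV[R]_n) *m U^T != 0.
  apply/eqP => /(congr1 (mulmx^~ U)); rewrite -mulmxA orthogonalC // mulmx1.
  by rewrite mul0mx => /rowP/(_ i)/eqP; rewrite !mxE !eqxx oner_eq0.
have := Apos _ d0; rewrite quadE AU !mulmxA -(mulmxA _ U^T) orthogonalC // mulmx1.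
rewrite frob_mulmxr trmxK -mulmxA orthogonalC // mulmx1 frob_mul_diag big_ord1.
rewrite (bigD1 i) //= big1 ?addr0 => [|j ji].
  by rewrite !mxE !eqxx !mulr1.
by rewrite !mxE (negPf ji) andbF !mulr0.
Qed.

Lemma conj_diagM U (x y : 'rV[R]_n) : orthogonal U ->
  (U *m diag_mx x *m U^T) *m (U *m diag_mx y *m U^T) =
  U *m diag_mx (\row_i (x 0 i * y 0 i)) *m U^T.
Proof.
move=> oU; rewrite !mulmxA -(mulmxA _ U^T) orthogonalC // mulmx1.
rewrite -(mulmxA U); congr (U *m _ *m _).
apply/matrixP => i j; rewrite mul_diag_mx !mxE.
by case: eqVneq => [->|_]; rewrite ?mulr1n ?mulr0n ?mulr0.
Qed.

Lemma conj_diag1 U (x : 'rV[R]_n) : orthogonal U -> (forall i, x 0 i = 1) ->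
  U *m diag_mx x *m U^T = 1%:M.
Proof.
move=> oU x1; have -> : x = const_mx 1 by apply/rowP => i; rewrite x1 mxE.
by rewrite diag_const_mx mulmx1.
Qed.

Lemma spd_unitmx A : spd A -> A \in unitmx.
Proof.
case/spd_spectral => U [v [oU _ v0 ->]]; rewrite unitmxE det_conj_diag //.
by rewrite unitfE; apply/prodf_neq0 => i _; rewrite gt_eqF.
Qed.

Lemma invmx_left A B : B *m A = 1%:M -> invmx A = B.
Proof.
by move=> BA; have [_ Au] := mulmx1_unit BA; rewrite -[LHS]mul1mx -BA mulmxK.
Qed.

Lemma invmx_conj_diag U v : orthogonal U -> (forall i, 0 < v 0 i) ->
  invmx (U *m diag_mx v *m U^T) = U *m diag_mx (map_mx GRing.inv v) *m U^T.
Proof.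
move=> oU v0; apply: invmx_left; rewrite conj_diagM // conj_diag1 // => i.
by rewrite !mxE mulVf ?gt_eqF.
Qed.

Lemma spd_inv A : spd A -> spd (invmx A).
Proof.
case/spd_spectral => U [v [oU _ v0 ->]]; rewrite invmx_conj_diag //.
by apply: spd_conj_diag => // i; rewrite mxE invr_gt0.
Qed.

Lemma spd_congr A P : P \in unitmx -> spd A -> spd (P *m A *m P^T).
Proof.
move=> Pu [As Apos]; split; first by rewrite /sym /= !trmx_mul trmxK As mulmxA.
move=> x x0; have xP : x *m P != 0.
  by apply: contra x0 => /eqP xP; rewrite -[x](mulmxK Pu) xP mul0mx.
by have := Apos _ xP; rewrite trmx_mul !mulmxA.
Qed.

Lemma spd_exp X : sym X -> spd (mxexp X).
Proof.
move=> /symmetric_spectral[U [v [oU ->]]]; rewrite /mxexp mxfunE //.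
by apply: spd_conj_diag => // i; rewrite mxE expR_gt0.
Qed.

Lemma mxlog_sym A : spd A -> sym (mxlog A).
Proof.
case/spd_spectral => U [v [oU _ v0 ->]]; rewrite /mxlog mxfunE //.
exact: symmetric_conj_diag.
Qed.

Lemma mxlogK A : spd A -> mxexp (mxlog A) = A.
Proof.
case/spd_spectral => U [v [oU _ v0 ->]]; rewrite /mxlog /mxexp !mxfunE //.
congr (_ *m diag_mx _ *m _); apply/rowP => i.
by rewrite !mxE lnK // posrE.
Qed.

Lemma mxexpK X : sym X -> mxlog (mxexp X) = X.
Proof.
move=> /symmetric_spectral[U [v [oU ->]]]; rewrite /mxlog /mxexp !mxfunE //.
by congr (_ *m diag_mx _ *m _); apply/rowP => i; rewrite !mxE expRK.
Qed.

Lemma mxlog_inv A : spd A -> mxlog (invmx A) = - mxlog A.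
Proof.
case/spd_spectral => U [v [oU _ v0 ->]]; rewrite invmx_conj_diag // /mxlog.
rewrite !mxfunE // -mulNmx -mulmxN -raddfN; congr (_ *m diag_mx _ *m _).
by apply/rowP => i; rewrite !mxE lnV // posrE.
Qed.

Lemma mxexpD U (x y : 'rV[R]_n) : orthogonal U ->
  mxexp (U *m diag_mx x *m U^T) *m mxexp (U *m diag_mx y *m U^T) =
  mxexp (U *m diag_mx (x + y) *m U^T).
Proof.
move=> oU; rewrite /mxexp !mxfunE // conj_diagM //.
by congr (_ *m diag_mx _ *m _); apply/rowP => i; rewrite !mxE expRD.
Qed.

Lemma invsqrtE (x : R) : 0 < x -> x `^ (- 2^-1) = (Num.sqrt x)^-1.
Proof. by move=> x0; rewrite powRN powR12_sqrt // ltW. Qed.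

Lemma mxinvsqrt_spd G : spd G -> spd (mxinvsqrt G).
Proof.
case/spd_spectral => U [v [oU _ v0 ->]]; rewrite /mxinvsqrt mxfunE //.
by apply: spd_conj_diag => // i; rewrite mxE powR_gt0.
Qed.

Lemma mxinvsqrt_sym G : spd G -> (mxinvsqrt G)^T = mxinvsqrt G.
Proof. by move/mxinvsqrt_spd => []. Qed.

Lemma mxinvsqrt_unitmx G : spd G -> mxinvsqrt G \in unitmx.
Proof. by move/mxinvsqrt_spd/spd_unitmx. Qed.

Lemma mxinvsqrt_sqr G : spd G -> mxinvsqrt G *m mxinvsqrt G = invmx G.
Proof.
case/spd_spectral => U [v [oU _ v0 ->]]; rewrite /mxinvsqrt mxfunE //.
rewrite invmx_conj_diag // conj_diagM //; congr (_ *m diag_mx _ *m _).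
apply/rowP => i; rewrite !mxE invsqrtE // -invfM -expr2 sqr_sqrtr //.
exact: ltW.
Qed.

Lemma spd_whiten G H : spd G -> spd H -> spd (whiten G H).
Proof.
move=> Gs Hs; rewrite /whiten -{2}(mxinvsqrt_sym Gs).
by apply: spd_congr => //; exact: mxinvsqrt_unitmx.
Qed.

Lemma char_poly_whiten G H : spd G ->
  char_poly (whiten G H) = char_poly (invmx G *m H).
Proof.
move=> Gs; have Ku := mxinvsqrt_unitmx Gs; rewrite -mxinvsqrt_sqr // /whiten.
rewrite -[RHS](char_poly_conj _ (mulVmx Ku)) !mulmxA mulVmx // mul1mx.
by [].
Qed.

End PositiveDefinite.

(** * Log-majorization of products of exponentials *)

Section LogMajorization.
Context {R : realType}.

Lemma ln_prod (I : finType) (F : I -> R) : (forall i, 0 < F i) ->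
  ln (\prod_i F i) = \sum_i ln (F i).
Proof.
move=> F0.
suff [] : 0 < \prod_i F i /\ ln (\prod_i F i) = \sum_i ln (F i) by [].
elim/big_rec2: _ => [|i x y _ [y0 <-]]; first by rewrite ln1.
by split; rewrite ?mulr_gt0 // lnM // posrE.
Qed.

(** From [1 + s <= exp s] at [s = x i - ln m], averaged. *)
Lemma jensen_exp (I : finType) (p x : I -> R) : (forall i, 0 <= p i) ->
  \sum_i p i = 1 -> 0 < \sum_i p i * expR (x i) ->
  \sum_i p i * x i <= ln (\sum_i p i * expR (x i)).
Proof.
move=> p0 p1 m0; set m := \sum_i _ in m0 *.
have : \sum_i p i * (1 + (x i - ln m)) <= \sum_i p i * (expR (x i) / m).
  apply: ler_sum => i _; apply: ler_wpM2l => //.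
  by apply: le_trans (expR_ge1Dx _) _; rewrite expRB lnK.
under [leRHS]eq_bigr do rewrite mulrA.
rewrite -mulr_suml divff ?gt_eqF //.
under eq_bigr do rewrite mulrDr mulrBr mulr1.
rewrite big_split sumrB /= -mulr_suml p1; lra.
Qed.

Lemma compression_diag k d (O : 'M[R]_(k, d)) (x : 'rV[R]_d) j :
  (O *m diag_mx x *m O^T) j j = \sum_i (O j i) ^+ 2 * x 0 i.
Proof.
rewrite mul_mx_diag mxE; apply: eq_bigr => i _; rewrite !mxE; ring.
Qed.

Lemma orthonormal_row_sum k d (O : 'M[R]_(k, d)) j : orthonormal_rows O ->
  \sum_i (O j i) ^+ 2 = 1.
Proof.
move=> oO; have /matrixP/(_ j j) := oO; rewrite !mxE eqxx mulr1n => <-.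
by apply: eq_bigr => i _; rewrite mxE expr2.
Qed.

Lemma compression_diag_gt0 k d (O : 'M[R]_(k, d)) (x : 'rV[R]_d) j :
  orthonormal_rows O -> (forall i, 0 < x 0 i) ->
  0 < (O *m diag_mx x *m O^T) j j.
Proof.
move=> oO x0; rewrite compression_diag lt0r.
apply/andP; split; last by apply: sumr_ge0 => i _; rewrite mulr_ge0 ?sqr_ge0 ?ltW.
apply/negP; rewrite psumr_eq0; last first.
  by move=> i _; rewrite mulr_ge0 ?sqr_ge0 ?ltW.
move=> /allP Ox; have := orthonormal_row_sum j oO.
rewrite big1 => [/eqP|i _]; first by rewrite eq_sym oner_eq0.
have /eqP := Ox i (mem_index_enum _).
by move=> /eqP; rewrite /= mulf_eq0 (gt_eqF (x0 i)) orbF => /eqP.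
Qed.

Lemma orthonormal_rowsM k d (P : 'M[R]_(k, d)) (Q : 'M[R]_k) (V : 'M[R]_d) :
  orthonormal_rows P -> orthogonal Q -> orthogonal V ->
  orthonormal_rows (Q^T *m P *m V).
Proof.
move=> oP oQ oV; rewrite /orthonormal_rows !trmx_mul trmxK !mulmxA.
rewrite -(mulmxA _ V) oV mulmx1 -(mulmxA _ P) oP mulmx1.
exact: orthogonalC.
Qed.

Lemma compression_spectral k d (P : 'M[R]_(k, d)) (Q : 'M[R]_k) (V : 'M[R]_d)
    (x : 'rV[R]_d) (b : 'rV[R]_k) : orthogonal Q ->
  P *m (V *m diag_mx x *m V^T) *m P^T = Q *m diag_mx b *m Q^T ->
  (Q^T *m P *m V) *m diag_mx x *m (Q^T *m P *m V)^T = diag_mx b.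
Proof.
move=> oQ PV; rewrite -[RHS](conj_orthogonalK _ oQ) -PV !trmx_mul trmxK.
by rewrite !mulmxA.
Qed.

(** In an eigenbasis of the compression of [exp X], each eigenvalue is an average
    of the [expR (x 0 i)] with weights of sum [1]; concavity of the logarithm
    bounds [log det] from below by the trace of the compression of [X]. *)
Lemma trace_le_lndet k d (P : 'M[R]_(k, d)) (V : 'M[R]_d) (x : 'rV[R]_d) :
  orthonormal_rows P -> orthogonal V ->
  \tr (P *m (V *m diag_mx x *m V^T) *m P^T) <=
  ln (\det (P *m (V *m diag_mx (map_mx expR x) *m V^T) *m P^T)).
Proof.
move=> oP oV; set E := V *m diag_mx (map_mx _ _) *m _.
have Es : (P *m E *m P^T)^T = P *m E *m P^T.
  by rewrite /E !trmx_mul !trmxK tr_diag_mx !mulmxA.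
have [Q [c [oQ _ PE]]] := sorted_spectral Es.
have oO := orthonormal_rowsM oP oQ oV; have cO := compression_spectral oQ PE.
set O := Q^T *m P *m V in oO cO.
have cj j : c 0 j = \sum_i (O j i) ^+ 2 * expR (x 0 i).
  have := compression_diag O (map_mx expR x) j; rewrite cO mxE eqxx mulr1n => ->.
  by apply: eq_bigr => i _; rewrite [map_mx _ _ _ _]mxE.
have c0 j : 0 < c 0 j.
  have := @compression_diag_gt0 _ _ O (map_mx expR x) j oO.
  by rewrite cO mxE eqxx mulr1n; apply => i; rewrite mxE expR_gt0.
rewrite PE det_conj_diag // ln_prod //.
have -> : \tr (P *m (V *m diag_mx x *m V^T) *m P^T) = \tr (O *m diag_mx x *m O^T).
  set N := P *m _ *m _; have -> : O *m diag_mx x *m O^T = Q^T *m (N *m Q).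
    by rewrite /O /N !trmx_mul trmxK !mulmxA.
  by rewrite [RHS]mxtrace_mulC -mulmxA oQ mulmx1.
rewrite /mxtrace; apply: ler_sum => j _; rewrite compression_diag cj.
by apply: jensen_exp => [i||]; rewrite ?sqr_ge0 ?orthonormal_row_sum // -cj.
Qed.

(** With [D = diag (exp (l / 2))], the spectrum [nu] of [D *m exp X *m D]
    log-majorizes [l + diag X] on the leading blocks: the determinant of such a
    block is bounded above by interlacing and below by [trace_le_lndet]. *)
Lemma log_majorization d (V W : 'M[R]_d) (x l z nu : 'rV[R]_d) :
  orthogonal V -> orthogonal W -> nonincreasing nu -> nonincreasing z ->
  (forall i, 0 < nu 0 i) ->
  diag_mx (map_mx (fun t => expR (t / 2)) l) *m
    (V *m diag_mx (map_mx expR x) *m V^T) *m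
    diag_mx (map_mx (fun t => expR (t / 2)) l) = W *m diag_mx nu *m W^T ->
  \sum_i z 0 i * (V *m diag_mx x *m V^T) i i <=
  \sum_i z 0 i * (ln (nu 0 i) - l 0 i).
Proof.
move=> oV oW nus zs nu0; set D := diag_mx (map_mx _ l).
set E := V *m diag_mx (map_mx expR x) *m V^T.
set M := V *m diag_mx x *m V^T => BW; set B := _ *m D in BW.
have BE i j : B i j = expR (l 0 i / 2) * E i j * expR (l 0 j / 2).
  by rewrite /B mul_mx_diag mul_diag_mx !mxE.
rewrite -subr_ge0 -sumrB; under eq_bigr do rewrite -mulrBr.
apply: (@abel_ge0 _ _ (fun i => z 0 i) (fun i => ln (nu 0 i) - l 0 i - M i i))
  => // [k kd|].
  pose P : 'M[R]_(k, d) := leading_rows kd.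
  have oP : orthonormal_rows P := leading_rows_orthonormal kd.
  have Bs : B^T = B by rewrite BW symmetric_conj_diag.
  have [Q [b [oQ bs PB]]] := sorted_spectral (leading_rows_symmetric kd Bs).
  have bnu := cauchy_interlacing kd oW nus BW oP oQ bs PB.
  have b0 i : 0 < b 0 i.
    have PB' : P *m (W *m diag_mx nu *m W^T) *m P^T = Q *m diag_mx b *m Q^T.
      by rewrite -BW.
    have := compression_diag_gt0 i (orthonormal_rowsM oP oQ oW) nu0.
    by rewrite (compression_spectral oQ PB') mxE eqxx mulr1n.
  pose lk : 'rV[R]_k := \row_i expR (l 0 (widen_ord kd i) / 2).
  have PBE : P *m B *m P^T = diag_mx lk *m (P *m E *m P^T) *m diag_mx lk.
    apply/matrixP => i j; rewrite mul_mx_diag mul_diag_mx leading_rows_conj BE.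
    by rewrite [RHS]mxE [X in _ = X * _]mxE leading_rows_conj /lk !mxE.
  have lnb : \sum_i ln (b 0 i) =
      \sum_(i < k) l 0 (widen_ord kd i) + ln (\det (P *m E *m P^T)).
    rewrite -ln_prod // -(det_conj_diag b oQ) -PB PBE !det_mulmx det_diag.
    have lk0 : 0 < \prod_i lk 0 i by apply: prodr_gt0 => i _; rewrite mxE expR_gt0.
    have detE : 0 < \det (P *m E *m P^T).
      have : 0 < \det (P *m B *m P^T).
        by rewrite PB det_conj_diag //; apply: prodr_gt0.
      by rewrite PBE !det_mulmx det_diag pmulr_lgt0 // pmulr_rgt0.
    rewrite !lnM ?posrE ?mulr_gt0 // ln_prod => [|i]; last by rewrite mxE expR_gt0.
    rewrite addrAC -big_split /=; congr (_ + _); apply: eq_bigr => i _.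
    by rewrite mxE expRK; field.
  rewrite !sumrB subr_ge0 lerBrDl.
  apply: (@le_trans _ _ (\sum_i ln (b 0 i))).
    rewrite lnb lerD2l; apply: le_trans (trace_le_lndet x oP oV).
    by rewrite /mxtrace; apply: ler_sum => i _; rewrite leading_rows_conj.
  by apply: ler_sum => i _; rewrite ler_ln ?posrE.
have detE : \det E = \prod_i expR (x 0 i).
  by rewrite det_conj_diag //; apply: eq_bigr => i _; rewrite mxE.
have : \det B = \prod_i nu 0 i by rewrite BW det_conj_diag.
rewrite /B det_mulmx [\det (D *m E)]det_mulmx det_diag detE.
have l0 : 0 < \prod_i map_mx (fun t => expR (t / 2)) l 0 i.
  by apply: prodr_gt0 => i _; rewrite mxE expR_gt0.
have x0 : 0 < \prod_i expR (x 0 i) by apply: prodr_gt0 => i _; rewrite expR_gt0.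
have lnl : ln (\prod_i map_mx (fun t => expR (t / 2)) l 0 i) = \sum_i l 0 i / 2.
  rewrite ln_prod => [|i]; last by rewrite mxE expR_gt0.
  by apply: eq_bigr => i _; rewrite mxE expRK.
have lnx : ln (\prod_i expR (x 0 i)) = \sum_i x 0 i.
  rewrite ln_prod => [|i]; last exact: expR_gt0.
  by apply: eq_bigr => i _; rewrite expRK.
move=> /(congr1 (@ln R)); rewrite !lnM ?posrE ?mulr_gt0 // lnl lnx ln_prod //.
rewrite !sumrB => <-; rewrite -/(\tr M) /M trace_conj_diag //.
rewrite -mulr_suml; lra.
Qed.

(** A Golden-Thompson majorization. The matrix [exp L *m exp X] is similar to
    [exp (L / 2) *m exp X *m exp (L / 2)], whose spectrum [nu] is bounded below by
    [log_majorization] in an eigenbasis common to [L] and [Z]. Since [Z] commutes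
    with [L], this says that replacing the logarithm of that matrix by [L + X] does
    not increase the pairing with [Z]. *)
Lemma exp_majorization d (U L X Z C : 'M[R]_d) (l z : 'rV[R]_d) :
  orthogonal U -> L = U *m diag_mx l *m U^T -> Z = U *m diag_mx z *m U^T ->
  nonincreasing z -> sym X -> char_poly C = char_poly (mxexp L *m mxexp X) ->
  exists nu : 'rV[R]_d,
    [/\ nonincreasing nu, forall i, 0 < nu 0 i,
        char_poly C = \prod_(i < d) ('X - (nu 0 i)%:P)
      & frob Z X <= \sum_i z 0 i * (ln (nu 0 i) - l 0 i)].
Proof.
move=> oU LU ZU zs Xs ->.
have [V [x [oV XV]]] := symmetric_spectral Xs.
have oUV : orthogonal (U^T *m V).
  by apply: orthogonalM => //; exact: orthogonal_tr.
have UXU (y : 'rV[R]_d) : U^T *m (V *m diag_mx y *m V^T) *m U =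
    (U^T *m V) *m diag_mx y *m (U^T *m V)^T.
  by rewrite trmx_mul trmxK !mulmxA.
pose D := diag_mx (map_mx (fun t => expR (t / 2)) l).
pose E := U^T *m mxexp X *m U.
have EE : E = (U^T *m V) *m diag_mx (map_mx expR x) *m (U^T *m V)^T.
  by rewrite /E XV /mxexp mxfunE // UXU.
have Du : D \in unitmx.
  rewrite unitmxE det_diag unitfE; apply/prodf_neq0 => i _.
  by rewrite mxE gt_eqF ?expR_gt0.
have Ds : D^T = D by rewrite tr_diag_mx.
have Bs : spd (D *m E *m D).
  rewrite -{2}Ds; apply: spd_congr => //; rewrite EE.
  by apply: spd_conj_diag => // i; rewrite mxE expR_gt0.
have [W [nu [oW nus nu0 BW]]] := spd_spectral Bs.
exists nu; split=> //.
  rewrite -(char_poly_conj_diag nu oW) -BW.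
  rewrite -[RHS](char_poly_conj _ (mulmxV Du)).
  rewrite -[RHS](char_poly_conj _ oU); congr char_poly.
  rewrite !mulmxA mulmxK // /E ?mulmxA.
  rewrite -[in RHS]mulmxA oU mulmx1; congr (_ *m _).
  rewrite LU /mxexp mxfunE //; congr (_ *m _).
  rewrite -mulmxA; congr (_ *m _).
  apply/matrixP => i j; rewrite mul_diag_mx !mxE.
  case: eqVneq => [->|_]; rewrite ?mulr1n ?mulr0n ?mulr0 // -expRD.
  by congr expR; field.
rewrite ZU frob_conj // frob_diag XV UXU.
by apply: (log_majorization oUV oW) => //; rewrite -EE.
Qed.

End LogMajorization.

(** * Convex functions on matrix spaces *)

Section ConvexFunctions.
Context {R : realType}.

Definition convex {E : lmodType R} (f : E -> R) :=
  forall x y t, 0 <= t <= 1 -> f (t *: x + (1 - t) *: y) <= t * f x + (1 - t) * f y.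

Lemma convex_functionP (E : lmodType R) (f : E -> R) :
  convex_function setT (f : convex_lmodType E -> R^o) <-> convex f.
Proof.
split=> [cf x y t /andP[t0 t1]|cf t x y _ _].
  by have := cf (Itv01 t0 t1) x y; rewrite !inE; apply.
by apply: cf; rewrite ge0 le1.
Qed.

(** Hahn-Banach in coordinates: as long as [M] does not span, [c <= p] extends
    to one more direction [v] after subtracting from [p] a multiple of a
    functional that vanishes on [M] and not at [v]. *)
Lemma convex_minorant n m (M : 'M[R]_(m, n)) (p : 'rV[R]_n -> R) (c : R) :
  convex p -> (forall x, (x <= M)%MS -> c <= p x) ->
  exists y : 'cV[R]_n, M *m y = 0 /\ forall x, c + (x *m y) 0 0 <= p x.
Proof.
have [k] := ubnP (n - \rank M); elim: k m M p => // k IH m M p.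
rewrite ltnS => Mk pc cM.
have [Mfull|] := boolP (row_full M).
  exists 0; rewrite mulmx0; split=> // x; rewrite mulmx0 mxE addr0.
  by apply: cM; exact: submx_full.
rewrite -sub1mx => /row_subPn[i0]; set v := row i0 _ => vM.
pose A := [set a | exists s t, [/\ (s <= M)%MS, 0 < t & a = (c - p (s - t *: v)) / t]].
(* Difference quotients to the left of [v] are below those to its right. *)
have left_le_right s s' t t' : (s <= M)%MS -> (s' <= M)%MS -> 0 < t -> 0 < t' ->
    (c - p (s - t *: v)) / t <= (p (s' + t' *: v) - c) / t'.
  move=> sM sM' t0 t0'; have tt : 0 < t + t' by rewrite addr_gt0.
  rewrite ler_pdivrMr // mulrAC ler_pdivlMr //.
  pose r := t / (t + t').
  have r01 : 0 <= r <= 1.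
    by rewrite /r ler_pdivrMr // mul1r lerDl (ltW t0') divr_ge0 ?(ltW t0) ?(ltW tt).
  have := pc (s' + t' *: v) (s - t *: v) r r01.
  have -> : r *: (s' + t' *: v) + (1 - r) *: (s - t *: v) = r *: s' + (1 - r) *: s.
    have rt : r * t' = (1 - r) * t by rewrite /r; field; rewrite gt_eqF.
    rewrite !scalerDr scalerN !scalerA rt addrACA subrr addr0.
    by [].
  have /cM : ((r *: s' + (1 - r) *: s)%R <= M)%MS by rewrite addmx_sub ?scalemx_sub.
  move: (p (s - _)) (p (s' + _)) (p _) => a b e ce H.
  have /(le_trans ce) := H => {}H.
  have E : r * b + (1 - r) * a = (t * b + t' * a) / (t + t').
    by rewrite /r; field; rewrite gt_eqF.
  move: H; rewrite E ler_pdivlMr // => H.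
  have {}H : c * t + c * t' <= t * b + t' * a by rewrite -mulrDr.
  lra.
have A0 : A !=set0 by exists ((c - p (0 - 1 *: v)) / 1), 0, 1; rewrite sub0mx.
have Aub : has_sup A.
  split=> //; exists ((p (0 + 1 *: v) - c) / 1) => _ [s [t [sM t0 ->]]].
  by apply: left_le_right; rewrite ?sub0mx.
pose a := sup A.
have pa s t : (s <= M)%MS -> c <= p (s + t *: v) - a * t.
  move=> sM; have [t0|t0|->] := ltgtP t 0; last first.
  - by rewrite scale0r addr0 mulr0 subr0; exact: cM.
  - have : a <= (p (s + t *: v) - c) / t.
      apply: ge_sup => // _ [s' [t' [s'M t0' ->]]].
      exact: left_le_right.
    by rewrite ler_pdivlMr //; lra.
  - have nt0 : 0 < - t by rewrite oppr_gt0.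
    have : (c - p (s - (- t) *: v)) / (- t) <= a.
      by apply: ub_le_sup; [case: Aub|exists s, (- t)].
    by rewrite scaleNr opprK ler_pdivrMr //; lra.
have [j vj] : exists j, (v *m cokermx M) 0 j != 0.
  by apply/rV0Pn; rewrite -submxE.
have [tau [Mtau vtau]] : exists tau : 'cV[R]_n, M *m tau = 0 /\ v *m tau = 1%:M.
  exists (((v *m cokermx M) 0 j)^-1 *: col j (cokermx M)); split.
    by rewrite -scalemxAr colE (mulmxA M) mulmx_coker mul0mx scaler0.
  have vcol : v *m col j (cokermx M) = col j (v *m cokermx M).
    by rewrite !colE !mulmxA.
  rewrite -scalemxAr vcol; move: (v *m cokermx M) vj => u uj.
  by apply/matrixP => i i'; rewrite !ord1 !mxE mulVf.
pose p' x := p x - a * (x *m tau) 0 0.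
have pc' : convex p'.
  move=> x y t t01; rewrite /p' mulmxDl -!scalemxAl !mxE.
  have := pc x y t t01; lra.
have [y [My py]] : exists y : 'cV[R]_n,
    (M + v)%MS *m y = 0 /\ forall x, c + (x *m y) 0 0 <= p' x.
  apply: IH => //.
    have : (M < M + v)%MS.
      by rewrite /ltmx addsmxSl /= addsmx_sub submx_refl.
    rewrite ltmxErank => /andP[_ rk]; apply: leq_trans Mk.
    by rewrite ltn_sub2l // (leq_trans rk) // rank_leq_col.
  move=> x /sub_addsmxP[[u1 u2] /= ->].
  rewrite [u2]mx11_scalar mul_scalar_mx /p' mulmxDl -mulmxA Mtau mulmx0 add0r.
  rewrite -scalemxAl vtau mxE mxE eqxx mulr1n mulr1.
  by apply: pa; exact: submxMl.
exists (y + a *: tau); split.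
  rewrite mulmxDr -scalemxAr Mtau scaler0 addr0.
  have /submxP[D ->] := addsmxSl M v; by rewrite -mulmxA My mulmx0.
move=> x; have := py x; rewrite /p' mulmxDr -scalemxAr.
by rewrite [X in _ -> _ + X <= _]mxE [X in _ -> _ + (_ + X) <= _]mxE; lra.
Qed.

Lemma frob_mxvec m n (A B : 'M[R]_(m, n)) : frob A B = frob (mxvec A) (mxvec B).
Proof.
rewrite frobE frob_rV pair_bigA /=.
rewrite (reindex _ (curry_mxvec_bij m n)) /=.
by apply: eq_bigr => -[i j] _ /=; rewrite !mxvecE.
Qed.

(** Convex sandwich along the subspace [D w]: the linear minorant is a subgradient
    at [0] that is orthogonal to the subspace. *)
Lemma matrix_subgradient m n k (p : 'M[R]_(m, n) -> R)
    (D : {linear 'rV[R]_k -> 'M[R]_(m, n)}) :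
  convex p -> (forall w, p 0 <= p (D w)) ->
  exists Y, (forall X, p 0 + frob Y X <= p X) /\ (forall w, frob Y (D w) = 0).
Proof.
move=> pc pD; pose q (x : 'rV[R]_(m * n)) := p (vec_mx x).
have qc : convex q.
  by move=> x y t t01; rewrite /q linearD !linearZ /=; exact: pc.
pose M := lin1_mx (mxvec \o D).
have [|y [My qy]] := convex_minorant (M := M) (c := p 0) qc.
  by move=> _ /submxP[w ->]; rewrite /q mul_rV_lin1 /= mxvecK.
have frobY X : frob (vec_mx y^T) X = (mxvec X *m y) 0 0.
  by rewrite frob_mxvec vec_mxK frobC -[y in RHS]trmxK frob_rVE mxE mulr1n.
exists (vec_mx y^T); split=> [X|w]; first by rewrite frobY -{2}(mxvecK X); exact: qy.
rewrite frobY -[mxvec _](@mul_rV_lin1 _ _ _ (mxvec \o D)).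
by rewrite -mulmxA My mulmx0 mxE.
Qed.

Lemma subgradient_exists m n (f : 'M[R]_(m, n) -> R) X : convex f ->
  exists Z, forall Y, f X + frob Z (Y - X) <= f Y.
Proof.
move=> fc; pose p H := f (X + H).
have pc : convex p.
  move=> x y t t01; rewrite /p.
  have -> : X + (t *: x + (1 - t) *: y) = t *: (X + x) + (1 - t) *: (X + y).
    by apply/matrixP => i j; rewrite !mxE; ring.
  exact: fc.
have [|Z [pZ _]] := matrix_subgradient (D := \0 : 'rV[R]_0 -> _) pc.
  by [].
by exists Z => Y; have := pZ (Y - X); rewrite /p addr0 subrKC.
Qed.

Lemma convex_line n (f : 'rV[R]_n -> R) (B : R) x h t : convex f ->
  0 <= t <= 1 -> f (x + h) <= B -> f (x + t *: h) <= f x + t * (B - f x).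
Proof.
move=> fc t01 fB; have := fc (x + h) x t t01.
have -> : t *: (x + h) + (1 - t) *: x = x + t *: h.
  by apply/rowP => j; rewrite !mxE; ring.
move/le_trans; apply; by have /andP[t0 _] := t01; have := ler_wpM2l t0 fB; lra.
Qed.

(** Coordinate by coordinate: a unit cube is covered by segments that join two
    cubes of one dimension less. *)
Lemma convex_locally_bounded n (f : 'rV[R]_n -> R) (x : 'rV[R]_n) : convex f ->
  exists B, forall h : 'rV[R]_n, (forall i, `|h 0 i| <= 1) -> f (x + h) <= B.
Proof.
move=> fc.
suff H (k : nat) (y : 'rV[R]_n) : exists B, forall h : 'rV[R]_n,
    (forall i, `|h 0 i| <= 1) -> (forall i : 'I_n, (k <= i)%N -> h 0 i = 0) ->
    f (y + h) <= B.
  have [B fB] := H n x; exists B => h h1; apply: fB => // i.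
  by rewrite leqNgt ltn_ord.
elim: k y => [|k IH] y.
  exists (f y) => h _ h0; rewrite (_ : h = 0) ?addr0 //.
  by apply/rowP => i; rewrite h0 ?mxE.
have [nk|kn] := leqP n k.
  have [B fB] := IH y; exists B => h h1 h0; apply: fB => // i ki.
  by have := leq_trans nk ki; rewrite leqNgt ltn_ord.
pose e := delta_mx 0 (Ordinal kn) : 'rV[R]_n.
have [B1 fB1] := IH (y + e); have [B2 fB2] := IH (y - e).
exists (Num.max B1 B2) => h h1 h0; pose s := h 0 (Ordinal kn).
pose h' := h - s *: e.
have s1 : `|s| <= 1 by exact: h1.
have h'E i : h' 0 i = if i == Ordinal kn then 0 else h 0 i.
  rewrite !mxE eqxx /=; case: eqVneq => [->|_]; first by rewrite mulr1 subrr.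
  by rewrite mulr0 subr0.
have h'1 i : `|h' 0 i| <= 1 by rewrite h'E; case: ifP => // _; rewrite normr0.
have h'0 (i : 'I_n) : (k <= i)%N -> h' 0 i = 0.
  move=> ki; rewrite h'E; case: eqVneq => // ik; apply: h0.
  rewrite ltn_neqAle ki andbT; apply: contra ik => /eqP ki'.
  by apply/eqP/val_inj.
have t01 : 0 <= (1 + s) / 2 <= 1 by move: s1; rewrite ler_norml; lra.
have := fc (y + e + h') (y - e + h') ((1 + s) / 2) t01.
have -> : ((1 + s) / 2) *: (y + e + h') + (1 - (1 + s) / 2) *: (y - e + h') = y + h.
  by apply/rowP => i; rewrite /h' !mxE; field.
move/le_trans; apply.
have {fB1} := fB1 _ h'1 h'0; have {fB2} := fB2 _ h'1 h'0.
move: t01 => /andP[]; set t := (1 + s) / 2; rewrite -subr_ge0 subr0 => t0.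
rewrite -subr_ge0 => t1 B2h B1h.
have M1 : B1 <= Num.max B1 B2 by rewrite le_max lexx.
have M2 : B2 <= Num.max B1 B2 by rewrite le_max lexx orbT.
have := ler_wpM2l t0 (le_trans B1h M1); have := ler_wpM2l t1 (le_trans B2h M2).
lra.
Qed.

Lemma norm_coord m n (h : 'M[R]_(m, n)) i j : `|h i j| <= `|h|.
Proof.
by rewrite [leRHS]/Num.norm /= mx_normrE; apply: (@le_bigmax _ _ _ _ (fun ij => `|h ij.1 ij.2|) (i, j)).
Qed.

(** Squeezed between a subgradient from below and, from above, the chords to the
    boundary of a cube on which [f] is bounded. *)
Lemma convex_continuous n (f : 'rV[R]_n -> R) : convex f -> continuous f.
Proof.
move=> fc x; have [B fB] := convex_locally_bounded x fc.
have [z fz] := subgradient_exists x fc.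
have yx : (fun y : 'rV[R]_n => y - x) @ x --> (0 : 'rV[R]_n).
  rewrite -(subrr x); exact: (cvgB (f := id) cvg_id (cvg_cst x)).
apply: (@squeeze_cvgr _ (nbhs x) _ _ (fun y => f x + frob z (y - x))
                      (fun y => f x + `|y - x| * (B - f x)) f _ (f x)).
- near=> y; rewrite fz /=.
  have yx1 : `|y - x| <= 1.
    by near: y; apply: (cvgr_norm_le 0 yx); rewrite normr0.
  have [->|yx0] := eqVneq y x; first by rewrite subrr normr0 mul0r addr0.
  have n0 : `|y - x| != 0 by rewrite normr_eq0 subr_eq0.
  have {1}-> : y = x + `|y - x| *: (`|y - x|^-1 *: (y - x)).
    by rewrite scalerA divff // scale1r subrKC.
  apply: convex_line => //; first by rewrite normr_ge0.
  apply: fB => i; rewrite mxE normrM normfV normr_id.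
  by rewrite ler_pdivrMl ?mulr1 ?norm_coord // lt0r n0 normr_ge0.
- rewrite -[X in _ --> X]addr0 -(frob0r z); apply: cvgD; first exact: cvg_cst.
  exact: (cvg_frob (cvg_cst z) yx).
- rewrite -[X in _ --> X]addr0 -(mul0r (B - f x)); apply: cvgD; first exact: cvg_cst.
  apply: (cvgM (f := fun y => `|y - x|)) (cvg_cst _).
  by rewrite -[X in _ --> X](@normr0 _ 'rV[R]_n); exact: cvg_norm.
Unshelve. all: by end_near. Qed.

End ConvexFunctions.

(** * Subgradients of spectral functions *)

Section SpectralFunctions.
Context {R : realType} {d : nat} (phi : 'rV[R]_d -> R).
Hypotheses (phi_convex : convex phi) (phi_sym : permutation_invariant phi).
Implicit Types (G H L U V X Z : 'M[R]_d) (l z x : 'rV[R]_d).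

(** Exchanging two entries does not change [phi]: a subgradient has to be
    ordered like its base point. *)
Lemma subgradient_comonotone l z :
  (forall x, phi l + frob z (x - l) <= phi x) ->
  forall i j, 0 <= (z 0 i - z 0 j) * (l 0 i - l 0 j).
Proof.
move=> zl i j; have [->|ij] := eqVneq i j; first by rewrite !subrr mul0r.
have := zl (col_perm (tperm i j) l); rewrite phi_sym gerDl.
rewrite frob_rV (bigD1 i) //= (bigD1 j) ?(eq_sym j) //= big1.
  by rewrite !mxE tpermL tpermR; lra.
move=> k /andP[ki kj]; rewrite !mxE tpermD ?(eq_sym i) ?(eq_sym j) //.
by rewrite subrr mulr0.
Qed.

Lemma frob_col_perm (s : 'S_d) x z : frob (col_perm s x) (col_perm s z) = frob x z.
Proof.
rewrite !frob_rV [RHS](reindex_inj (@perm_inj _ s)) /=.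
by apply: eq_bigr => i _; rewrite !mxE.
Qed.

Lemma subgradient_col_perm (s : 'S_d) l z :
  (forall x, phi l + frob z (x - l) <= phi x) ->
  forall x, phi (col_perm s l) + frob (col_perm s z) (x - col_perm s l) <= phi x.
Proof.
move=> zl x; rewrite phi_sym.
have -> : x - col_perm s l = col_perm s (col_perm s^-1 x - l).
  by apply/rowP => i; rewrite !mxE permK.
by rewrite frob_col_perm; apply: le_trans (zl _) _; rewrite phi_sym.
Qed.

(** A common sorting permutation of a point and of a subgradient: sort their
    sum. *)
Lemma sorted_subgradient l z : (forall x, phi l + frob z (x - l) <= phi x) ->
  exists s : 'S_d, nonincreasing (col_perm s l) /\ nonincreasing (col_perm s z).
Proof.
move=> zl; have [s ss] := sorting_perm (l + z); exists s.
have co := subgradient_comonotone (subgradient_col_perm s zl); clear zl.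
move: ss co; have -> : col_perm s (l + z) = col_perm s l + col_perm s z.
  by apply/rowP => i; rewrite !mxE.
move: (col_perm s l) (col_perm s z) => {}l {}z lz co.
have H (i j : 'I_d) : (i <= j)%N -> l 0 j <= l 0 i /\ z 0 j <= z 0 i.
  move=> ij; have := lz i j ij; rewrite !mxE => lzij; have := co i j.
  have [lij|lij] := leP (l 0 j) (l 0 i); have [zij|zij] := leP (z 0 j) (z 0 i) => //.
  - move=> cij; exfalso; have [e|ne] := eqVneq (l 0 i) (l 0 j); first by lra.
    have lt : 0 < l 0 i - l 0 j by rewrite subr_gt0 lt_neqAle eq_sym ne.
    by move: cij; rewrite pmulr_lge0 //; lra.
  - move=> cij; exfalso; have lt : l 0 i - l 0 j < 0 by rewrite subr_lt0.
    by move: cij; rewrite nmulr_lge0 //; lra.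
  - by exfalso; lra.
by split=> i j /H[].
Qed.

(** A subgradient of [phi] at the eigenvalues, put on the diagonal of the same
    eigenbasis: once both are sorted, the trace inequality extends the subgradient
    inequality from diagonal matrices to all symmetric ones. *)
Lemma spectral_subgradient_exists L : sym L ->
  exists Z, subdifferential sym (fun X => phi (eigvals X)) L Z.
Proof.
move=> /symmetric_spectral[U0 [l0 [oU0 LU0]]].
have [z0 zl0] := subgradient_exists l0 phi_convex.
have [s [ls zs]] := sorted_subgradient zl0.
have zl := subgradient_col_perm s zl0.
have oU := orthogonal_col_perm s oU0.
have LU : L = col_perm s U0 *m diag_mx (col_perm s l0) *m (col_perm s U0)^T.
  by rewrite col_perm_diag.
move: oU LU ls zs zl; move: (col_perm s U0) (col_perm s l0) (col_perm s z0).
move=> U l z oU LU ls zs zl.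
exists (U *m diag_mx z *m U^T); split; first exact: symmetric_conj_diag.
move=> Y Ys; have [V [y [oV ys YV]]] := sorted_spectral Ys.
rewrite LU YV !symmetric_eigvals //; apply: le_trans (zl y).
rewrite lerD2l !frobBr frob_conjK // frob_diag_diag lerD2r.
exact: (von_neumann oU oV zs ys erefl erefl).
Qed.

(** A matrix subgradient attains equality in the trace inequality, hence is
    diagonal in a common eigenbasis. *)
Lemma spectral_subgradient_diag L Z : sym L ->
  subdifferential sym (fun X => phi (eigvals X)) L Z ->
  exists U l z, [/\ orthogonal U, nonincreasing l /\ nonincreasing z,
    L = U *m diag_mx l *m U^T, Z = U *m diag_mx z *m U^T
    & forall x, phi l + frob z (x - l) <= phi x].
Proof.
move=> Ls [Zs ZL].
have [U [l [oU ls LU]]] := sorted_spectral Ls.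
have [V [z [oV zs ZV]]] := sorted_spectral Zs.
have ZX x : phi l + (frob z x - frob Z L) <= phi x.
  have := ZL (V *m diag_mx x *m V^T) (symmetric_conj_diag _ _).
  rewrite frobBr {1}ZV frob_conjK // frob_diag_diag.
  by rewrite {1}LU !symmetric_eigvals.
have zlZL : frob z l <= frob Z L by have := ZX l; lra.
have [W [oW ZW LW]] := von_neumann_eq oV oU zs ls ZV LU zlZL.
exists W, l, z; split => // x; rewrite frobBr.
have := von_neumann oV oU zs ls ZV LU.
by have := ZX x; lra.
Qed.

Lemma Omega_mxlog H G : spd G -> spd H ->
  Omega phi H G = phi (eigvals (mxlog (whiten G H))).
Proof.
move=> Gs Hs; have [U [v [oU _ v0 E]]] := spd_spectral (spd_whiten Gs Hs).
rewrite /Omega E /mxlog mxfunE // symmetric_eigvals //.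
by rewrite (symmetric_fun_eigvals _ phi_sym (char_poly_conj_diag v oU)).
Qed.

(** [whiten G' H] has the spectrum of [G'^-1 H], which [whiten G H] and
    [whiten G G'] determine up to similarity. *)
Lemma char_poly_whiten_quotient G G' H : spd G -> spd G' ->
  char_poly (whiten G' H) =
  char_poly (whiten G H *m invmx (whiten G G')).
Proof.
move=> Gs Gs'; rewrite char_poly_whiten //.
have Ku := mxinvsqrt_unitmx Gs; have Gu' := spd_unitmx Gs'.
have -> : invmx (whiten G G') =
    invmx (mxinvsqrt G) *m invmx G' *m invmx (mxinvsqrt G).
  apply: invmx_left; rewrite /whiten !mulmxA.
  rewrite mulmxKV // -(mulmxA _ (invmx G')) mulVmx // mulmx1.
  by rewrite mulVmx.
rewrite /whiten !mulmxA mulmxK //.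
rewrite -(mulmxA _ H) char_poly_conj ?mulmxV //.
rewrite -[RHS](char_poly_conj _ (mulVmx Gu')) !mulmxA.
by rewrite mulmxKV.
Qed.

(** The first-order inequality of geodesic convexity. When [G] moves to [G'] along
    a geodesic, of whitened velocity [mxlog (whiten G G')], the logarithm of
    [whiten G H] starts in the opposite direction, up to a term orthogonal to the
    matrices that commute with it, as [Z] does. *)
Lemma Omega_subgradient H G G' Z : spd H -> spd G -> spd G' ->
  spectral_subdiff phi H G Z ->
  Omega phi H G - frob Z (mxlog (whiten G G')) <= Omega phi H G'.
Proof.
move=> Hs Gs Gs' ZG; have Ls := mxlog_sym (spd_whiten Gs Hs).
have Ws := spd_whiten Gs Gs'.
have [U [l [z [oU [_ zs] LU ZU zl]]]] := spectral_subgradient_diag Ls ZG.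
have Xs : sym (- mxlog (whiten G G')).
  by rewrite /sym /= linearN /= (mxlog_sym Ws).
have CE : char_poly (whiten G' H) =
    char_poly (mxexp (mxlog (whiten G H)) *m mxexp (- mxlog (whiten G G'))).
  rewrite (mxlogK (spd_whiten Gs Hs)) -(mxlog_inv Ws) (mxlogK (spd_inv Ws)).
  exact: char_poly_whiten_quotient.
have [nu [_ nu0 Cnu Znu]] := exp_majorization oU LU ZU zs Xs CE.
rewrite (Omega_mxlog Gs Hs) {1}LU (symmetric_eigvals _ phi_sym oU).
rewrite /Omega (symmetric_fun_eigvals _ phi_sym Cnu).
apply: le_trans (zl _); rewrite lerD2l -frobNr; apply: le_trans Znu _.
by rewrite frob_rV; apply: ler_sum => i _; rewrite !mxE.
Qed.

(** By the trace inequality, sorted spectra are at most as far apart as the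
    matrices. *)
Lemma spectral_function_cvg {T : Type} {F : set_system T} {FF : Filter F}
    (A : T -> 'M[R]_d) (B : 'M[R]_d) : sym B ->
  (\forall t \near F, sym (A t)) -> A t @[t --> F] --> B ->
  phi (eigvals (A t)) @[t --> F] --> phi (eigvals B).
Proof.
move=> Bs As AB; have [V [b [oV bs BV]]] := sorted_spectral Bs.
have /choice[a aE] t : exists v, sym (A t) ->
    phi (eigvals (A t)) = phi v /\
    frob (v - b) (v - b) <= frob (A t - B) (A t - B).
  have [As'|nAs] := pselect (sym (A t)); last by exists 0.
  have [U [v [oU vs AU]]] := sorted_spectral As'.
  exists v => _; split; first by rewrite AU symmetric_eigvals.
  have := von_neumann oU oV vs bs AU BV.
  rewrite !frobBl !frobBr (frobC B) (frobC b).
  have -> : frob (A t) (A t) = frob v v by rewrite AU frob_conjK // frob_diag_diag.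
  have -> : frob B B = frob b b by rewrite BV frob_conjK // frob_diag_diag.
  lra.
have ab : a t @[t --> F] --> b.
  apply/cvg_frob0P; move/cvg_frob0P: AB => AB.
  apply: (squeeze_cvgr _ (cvg_cst 0) AB).
  by apply: filterS As => t /aE[_ ->]; rewrite frob_ge0.
have -> : phi (eigvals B) = phi b by rewrite BV symmetric_eigvals.
have pab : phi (a t) @[t --> F] --> phi b.
  exact: (cvg_comp a phi ab (@convex_continuous _ _ _ phi_convex b)).
apply: cvg_trans pab; apply: near_eq_cvg.
by apply: filterS As => t /aE[-> _].
Qed.

End SpectralFunctions.

(** * Continuity of the functional calculus *)

Lemma cvg_near_eq {T : Type} {F : set_system T} {FF : Filter F}
    {U : topologicalType} (f g : T -> U) (l : U) :
  f x @[x --> F] --> l -> (\forall x \near F, f x = g x) ->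
  g x @[x --> F] --> l.
Proof. by move=> fl fg; apply: cvg_trans fl; exact: near_eq_cvg. Qed.

Lemma lipschitz_sqr {R : realType} (I : R -> Prop) (f : R -> R) (k : R) :
  (forall x y, I x -> I y -> x <= y -> `|f x - f y| <= k * (y - x)) ->
  forall s t, I s -> I t -> (f s - f t) ^+ 2 <= k ^+ 2 * (s - t) ^+ 2.
Proof.
move=> fk s t; wlog st : s t / s <= t => [H Is It|Is It].
  have [|/ltW ts] := leP s t; first by move=> ?; exact: H.
  by rewrite -sqrrN opprB -[(s - t) ^+ 2]sqrrN opprB; exact: H.
have H := fk s t Is It st; have := ler_pM (normr_ge0 _) (normr_ge0 _) H H.
by rewrite -expr2 real_normK ?num_real //; lra.
Qed.

Lemma sqr_dist_le {R : realType} (s t e : R) : 0 <= e ->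
  (s - t) ^+ 2 <= e ^+ 2 -> - e <= s - t <= e.
Proof.
move=> e0; rewrite -ler_norml -(real_normK (num_real (s - t))).
by rewrite ler_pXn2r ?nnegrE.
Qed.

Section FunctionalCalculusLimits.
Context {R : realType} {d : nat}.
Context {T : Type} {F : set_system T} {FF : Filter F}.
Implicit Types (B G U X : 'M[R]_d) (A : T -> 'M[R]_d).

Lemma sorted_spectrum_dist B C U V (a b : 'rV[R]_d) i :
  orthogonal U -> orthogonal V -> nonincreasing a -> nonincreasing b ->
  B = U *m diag_mx a *m U^T -> C = V *m diag_mx b *m V^T ->
  (a 0 i - b 0 i) ^+ 2 <= frob (B - C) (B - C).
Proof.
move=> oU oV as_ bs BU CV; have := von_neumann oU oV as_ bs BU CV.
have := frob_coord_le (a - b) 0 i; rewrite !mxE.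
rewrite !frobBl !frobBr (frobC C B) (frobC b a).
have -> : frob B B = frob a a by rewrite BU frob_conjK // frob_diag_diag.
have -> : frob C C = frob b b by rewrite CV frob_conjK // frob_diag_diag.
lra.
Qed.

Lemma mxfun_cvg (f : R -> R) (I J : R -> Prop) (K e : R) A B :
  (forall s t, I s -> I t -> (f s - f t) ^+ 2 <= K * (s - t) ^+ 2) ->
  0 < e -> (forall s t, J t -> (s - t) ^+ 2 <= e -> I s) ->
  (exists V b, [/\ orthogonal V, nonincreasing b, (forall i, J (b 0 i))
                 & B = V *m diag_mx b *m V^T]) ->
  (\forall t \near F, sym (A t)) -> A t @[t --> F] --> B ->
  mxfun f (A t) @[t --> F] --> mxfun f B.
Proof.
move=> fK e0 IJ [V [b [oV bs Jb BV]]] As /cvg_frob0P AB.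
apply/cvg_frob0P.
apply: (squeeze_cvgr (f := fun=> 0) (h := fun t => K * frob (A t - B) (A t - B))).
- near=> t; have ABe : frob (A t - B) (A t - B) <= e.
    by near: t; exact: (cvgr_le 0 AB).
  have [U [a [oU as_ AU]]] : exists U a,
      [/\ orthogonal U, nonincreasing a & A t = U *m diag_mx a *m U^T].
    by apply: sorted_spectral; near: t.
  rewrite frob_ge0 /= [in leLHS]AU [in leRHS]AU [in leLHS]BV [in leRHS]BV.
  apply: (mxfun_lipschitz fK) => // i.
    apply: (IJ _ _ (Jb i)); apply: le_trans ABe.
    exact: (sorted_spectrum_dist _ oU oV).
  by apply: (IJ _ _ (Jb i)); rewrite subrr expr0n ltW.
- exact: cvg_cst.
- by rewrite -(mulr0 K); apply: cvgM => //; exact: cvg_cst.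
Unshelve. all: by end_near. Qed.

Lemma mxfun_cvg_spd (f : R -> R) A B :
  (forall m : R, 0 < m -> exists K, forall s t, m <= s -> m <= t ->
     (f s - f t) ^+ 2 <= K * (s - t) ^+ 2) ->
  spd B -> (\forall t \near F, sym (A t)) -> A t @[t --> F] --> B ->
  mxfun f (A t) @[t --> F] --> mxfun f B.
Proof.
move=> fK Bs As AB; have [V [b [oV bs b0 BV]]] := spd_spectral Bs.
pose m := \big[Num.min/1]_i b 0 i.
have m0 : 0 < m by apply: lt_bigmin.
have mb i : m <= b 0 i by exact: bigmin_le.
have m2 : 0 < m / 2 by rewrite divr_gt0.
have [K {}fK] := fK _ m2.
apply: (mxfun_cvg (I := fun s => m / 2 <= s) (J := fun s => m <= s)
  (e := (m / 2) ^+ 2) fK) => //.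
- by rewrite exprn_gt0.
- by move=> s t mt /(sqr_dist_le (ltW m2)); lra.
- by exists V, b; split.
Qed.

Lemma mxlog_cvg A B : spd B ->
  (\forall t \near F, sym (A t)) -> A t @[t --> F] --> B ->
  mxlog (A t) @[t --> F] --> mxlog B.
Proof.
apply: mxfun_cvg_spd => m m0; exists (m^-1 ^+ 2).
apply: (lipschitz_sqr (I := fun s => m <= s)) => x y mx my xy.
have x0 : 0 < x := lt_le_trans m0 mx; have y0 : 0 < y := lt_le_trans m0 my.
rewrite distrC -ln_div ?posrE // ger0_norm; last first.
  by rewrite ln_ge0 // ler_pdivlMr // mul1r.
have -> : y / x = 1 + (y - x) / x by field; rewrite gt_eqF.
apply: le_trans (le_ln1Dx _) _.
  by apply: (@lt_le_trans _ _ 0); rewrite ?ltrN10 // divr_ge0 ?subr_ge0 // ltW.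
by rewrite mulrC ler_wpM2r ?subr_ge0 // lef_pV2 ?posrE.
Qed.

Lemma mxinvsqrt_cvg A B : spd B ->
  (\forall t \near F, sym (A t)) -> A t @[t --> F] --> B ->
  mxinvsqrt (A t) @[t --> F] --> mxinvsqrt B.
Proof.
apply: mxfun_cvg_spd => m m0; pose r := Num.sqrt m.
have r0 : 0 < r by rewrite sqrtr_gt0.
exists (((r * r * r)^-1) ^+ 2).
apply: (lipschitz_sqr (I := fun s => m <= s)) => x y mx my xy.
have x0 : 0 < x := lt_le_trans m0 mx; have y0 : 0 < y := lt_le_trans m0 my.
rewrite !invsqrtE //; pose a := Num.sqrt x; pose b := Num.sqrt y.
have ra : r <= a by rewrite ler_wsqrtr.
have ab : a <= b by rewrite ler_wsqrtr.
have a0 : 0 < a by exact: lt_le_trans ra.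
have b0 : 0 < b by exact: lt_le_trans ab.
have xE : x = a * a by rewrite -expr2 sqr_sqrtr // ltW.
have yE : y = b * b by rewrite -expr2 sqr_sqrtr // ltW.
rewrite -/a -/b xE yE ger0_norm; last by rewrite subr_ge0 lef_pV2 ?posrE.
have -> : a^-1 - b^-1 = (b - a) / (a * b).
  by field; rewrite !gt_eqF.
have -> : (r * r * r)^-1 * (b * b - a * a) = (b - a) * ((a + b) / (r * r * r)).
  by field; rewrite gt_eqF.
have r3 : 0 < r * r * r by rewrite !mulr_gt0.
rewrite ler_wpM2l ?subr_ge0 // ler_pdivlMr // mulrC.
rewrite ler_pdivrMr ?mulr_gt0 // [leRHS]mulrC.
have rr : r * r <= a * b := ler_pM (ltW r0) (ltW r0) ra (le_trans ra ab).
apply: (ler_pM _ (ltW r0) rr); first by rewrite mulr_ge0 // ltW.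
by apply: (le_trans ra); rewrite lerDl ltW.
Qed.

Lemma mxexp_cvg A B : sym B ->
  (\forall t \near F, sym (A t)) -> A t @[t --> F] --> B ->
  mxexp (A t) @[t --> F] --> mxexp B.
Proof.
move=> /sorted_spectral[V [b [oV bs BV]]].
pose m := \big[Num.max/0]_i b 0 i.
have mb i : b 0 i <= m by exact: le_bigmax.
apply: (mxfun_cvg (I := fun s => s <= m + 1) (J := fun s => s <= m)
  (K := expR (m + 1) ^+ 2) (e := 1)) => //.
- apply: (lipschitz_sqr (I := fun s => s <= m + 1)) => x y mx my xy.
  rewrite distrC ger0_norm ?subr_ge0 ?ler_expR //.
  apply: (@le_trans _ _ (expR y * (y - x))); last first.
    by rewrite ler_wpM2r ?subr_ge0 // ler_expR.
  have -> : expR x = expR y * expR (x - y) by rewrite -expRD addrC subrK.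
  have := ler_wpM2l (expR_ge0 y) (expR_ge1Dx (x - y)); lra.
- move=> s t mt; rewrite -{1}[1](expr1n _ 2) => /(sqr_dist_le ler01); lra.
- by exists V, b; split.
Qed.

End FunctionalCalculusLimits.

Lemma ln_quadratic {R : realType} (x : R) : x ^+ 2 <= 4^-1 ->
  (ln (1 + x) - x) ^+ 2 <= 4 * (x ^+ 2 * x ^+ 2).
Proof.
move=> x4.
have x1 : - 2^-1 <= x by rewrite leNgt; apply/negP => ?; nra.
have x0 : 0 < 1 + x by lra.
have up : ln (1 + x) <= x by apply: le_ln1Dx; lra.
have low : x - 2 * x ^+ 2 <= ln (1 + x).
  have xi : 0 < (1 + x)^-1 by rewrite invr_gt0.
  have : ln (1 + ((1 + x)^-1 - 1)) <= (1 + x)^-1 - 1 by apply: le_ln1Dx; lra.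
  rewrite subrKC lnV ?posrE // => H.
  have : (1 + x)^-1 - 1 <= - x + 2 * x ^+ 2; last by lra.
  rewrite lerBlDr -[leLHS]mul1r ler_pdivrMr //; nra.
set y := ln (1 + x) - x; have y0 : y <= 0 by rewrite /y; lra.
have y1 : - (2 * x ^+ 2) <= y by rewrite /y; lra.
have x2 := sqr_ge0 x; nra.
Qed.

(** The logarithm is tangent to the identity at [1%:M], quadratically. *)
Lemma frob_mxlog_le {R : realType} {d : nat} (W : 'M[R]_d) : W^T = W ->
  frob (W - 1%:M) (W - 1%:M) <= 4^-1 ->
  frob (mxlog W - (W - 1%:M)) (mxlog W - (W - 1%:M)) <=
  4 * (frob (W - 1%:M) (W - 1%:M) * frob (W - 1%:M) (W - 1%:M)).
Proof.
move=> /symmetric_spectral[U [w [oU WU]]].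
have oneU : 1%:M = U *m diag_mx (const_mx 1) *m U^T.
  by rewrite diag_const_mx mulmx1 oU.
have W1 : W - 1%:M = U *m diag_mx (w - const_mx 1) *m U^T.
  by rewrite [in LHS]WU [in LHS]oneU raddfB /= mulmxBr mulmxBl.
have W2 : mxlog W - (W - 1%:M) =
    U *m diag_mx (map_mx (@ln R) w - (w - const_mx 1)) *m U^T.
  rewrite W1 [X in mxlog X]WU /mxlog mxfunE //.
  by rewrite -mulmxBl -mulmxBr -raddfB.
rewrite W2 W1 !frob_conjK // !frob_diag_diag; set v := w - const_mx 1 => v4.
have vi i : (v 0 i) ^+ 2 <= frob v v := frob_coord_le v 0 i.
rewrite [leLHS]frob_rV {1}frob_rV mulr_suml mulr_sumr; apply: ler_sum => i _.
have wE : w 0 i = 1 + v 0 i by rewrite /v !mxE; ring.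
rewrite mxE [(- v) 0 i]mxE [map_mx _ _ _ _]mxE wE.
rewrite -expr2; apply: le_trans (ln_quadratic (le_trans (vi i) v4)) _.
by rewrite ler_wpM2l // -expr2 ler_wpM2l // sqr_ge0.
Qed.

Lemma sym_cvg {R : realType} {d : nat} {T : Type} {F : set_system T}
    {FF : ProperFilter F} (A : T -> 'M[R]_d) (B : 'M[R]_d) :
  (\forall t \near F, sym (A t)) -> A t @[t --> F] --> B -> sym B.
Proof.
move=> As /cvg_mxP AB; apply/matrixP => i j; rewrite mxE.
have ABji : A t i j @[t --> F] --> B j i.
  apply: (cvg_near_eq (AB j i)); apply: filterS As => t At.
  by have /matrixP/(_ i j) := (At : _^T = _); rewrite mxE.
exact: (cvg_unique (@Rhausdorff R) ABji (AB i j)).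
Qed.

Lemma velocity_cvg {R : realType} {V : normedModType R} (c : R -> V) (x u : V) :
  t^-1 *: (c t - x) @[t --> 0^'+] --> u -> c t @[t --> 0^'+] --> x.
Proof.
move=> cu; have t0 : t @[t --> (0 : R)^'+] --> (0 : R).
  exact: cvg_at_right_filter cvg_id.
have H0 : t *: (t^-1 *: (c t - x)) + x @[t --> 0^'+] --> x.
  rewrite -[X in _ --> X]add0r -(scale0r u).
  by apply: cvgD; [exact: (cvgZ t0 cu)|exact: cvg_cst].
apply: (cvg_near_eq H0); near=> t.
have tp : 0 < t by near: t; exact: nbhs_right_gt.
by rewrite scalerA divff ?gt_eqF // scale1r subrK.
Unshelve. all: by end_near. Qed.

(** Curves through the identity have the same one-sided velocity as their
    logarithms. *)
Lemma mxlog_velocity {R : realType} {d : nat} (W : R -> 'M[R]_d) (Y : 'M[R]_d) :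
  (\forall t \near 0^'+, sym (W t)) ->
  t^-1 *: (W t - 1%:M) @[t --> 0^'+] --> Y ->
  t^-1 *: mxlog (W t) @[t --> 0^'+] --> Y.
Proof.
move=> Ws WY; pose q t := t^-1 *: (W t - 1%:M).
have t0 : t @[t --> (0 : R)^'+] --> (0 : R) by exact: cvg_at_right_filter cvg_id.
have W1 : W t - 1%:M @[t --> 0^'+] --> (0 : 'M[R]_d).
  have W0 : t *: (t^-1 *: (W t - 1%:M)) @[t --> 0^'+] --> (0 : 'M[R]_d).
    by rewrite -(scale0r Y); exact: cvgZ t0 WY.
  apply: (cvg_near_eq W0); near=> t.
  have tp : 0 < t by near: t; exact: nbhs_right_gt.
  by rewrite scalerA divff ?scale1r // gt_eqF.
have f0 : frob (W t - 1%:M) (W t - 1%:M) @[t --> 0^'+] --> (0 : R).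
  by rewrite -[X in _ --> X](frob0r (0 : 'M[R]_d)); exact: (cvg_frob W1 W1).
have fq : frob (q t) (q t) @[t --> 0^'+] --> frob Y Y by exact: cvg_frob.
suff H : t^-1 *: (mxlog (W t) - (W t - 1%:M)) @[t --> 0^'+] --> (0 : 'M[R]_d).
  have H' : t^-1 *: (mxlog (W t) - (W t - 1%:M)) + t^-1 *: (W t - 1%:M)
      @[t --> 0^'+] --> Y.
    by rewrite -[Y]add0r; exact: cvgD H WY.
  by apply: (cvg_near_eq H'); near=> t; rewrite /= -scalerDr subrK.
have i4 : (0 : R) < 4^-1 by rewrite invr_gt0.
apply/cvg_frob0P.
apply: (squeeze_cvgr (f := fun=> 0)
  (h := fun t => 4 * (frob (q t) (q t) * frob (W t - 1%:M) (W t - 1%:M)))).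
- near=> t; rewrite subr0 frob_ge0 /= frobZl frobZr.
  have tp : 0 < t by near: t; exact: nbhs_right_gt.
  have Wsm : frob (W t - 1%:M) (W t - 1%:M) <= 4^-1.
    by near: t; exact: (cvgr_le 0 f0 _ i4).
  have Wst : (W t)^T = W t by near: t; exact: Ws.
  have := frob_mxlog_le Wst Wsm; rewrite /q frobZl frobZr.
  move: (frob _ _) (frob _ _) => x y xy.
  have tt : 0 <= t^-1 * t^-1 by rewrite mulr_ge0 // invr_ge0 ltW.
  have := ler_wpM2l tt xy; lra.
- exact: cvg_cst.
- have lim : 4 * (frob (q t) (q t) * frob (W t - 1%:M) (W t - 1%:M))
      @[t --> 0^'+] --> 4 * (frob Y Y * 0 : R).
    exact: (cvgM (cvg_cst _) (cvgM fq f0)).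
  by rewrite !mulr0 in lim.
Unshelve. all: by end_near. Qed.

(** * Geodesics of the affine-invariant metric *)

Section Geodesics.
Context {R : realType} {d : nat}.
Implicit Types (P G H S X : 'M[R]_d).

Lemma permutation_invariant_frob : permutation_invariant (fun x : 'rV[R]_d => frob x x).
Proof. by move=> s x; rewrite frob_col_perm. Qed.

Lemma dAI_char_poly G H (v : 'rV[R]_d) : spd G -> spd H ->
  char_poly (invmx G *m H) = \prod_(i < d) ('X - (v 0 i)%:P) ->
  dAI G H = Num.sqrt (frob (map_mx (@ln R) v) (map_mx (@ln R) v)).
Proof.
move=> Gs Hs; rewrite -char_poly_whiten // => Gv.
have [U [w [oU _ w0 E]]] := spd_spectral (spd_whiten Gs Hs).
rewrite /dAI /fnorm; congr Num.sqrt.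
rewrite -(symmetric_fun_eigvals (@ln R) permutation_invariant_frob Gv).
rewrite E (symmetric_fun_eigvals _ permutation_invariant_frob
            (char_poly_conj_diag w oU)).
by rewrite /mxlog mxfunE // frob_conjK // frob_diag_diag.
Qed.

Lemma mxexp0 : mxexp (0 : 'M[R]_d) = 1%:M.
Proof.
have E : (0 : 'M[R]_d) = 1%:M *m diag_mx 0 *m 1%:M^T.
  by rewrite raddf0 mulmx0 mul0mx.
have o1 : orthogonal (1%:M : 'M[R]_d) by exact: orthogonal1.
rewrite [in LHS]E /mxexp mxfunE // conj_diag1 // => i.
by rewrite !mxE expR0.
Qed.

Lemma scale_conj_diag (U : 'M[R]_d) (x : 'rV[R]_d) t :
  t *: (U *m diag_mx x *m U^T) = U *m diag_mx (t *: x) *m U^T.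
Proof.
have -> : diag_mx (t *: x) = t *: diag_mx x by rewrite linearZ.
by rewrite -scalemxAr -scalemxAl.
Qed.

Lemma mxexp_addZ X s t : sym X ->
  mxexp (s *: X) *m mxexp (t *: X) = mxexp ((s + t) *: X).
Proof.
move=> /symmetric_spectral[U [x [oU ->]]].
by rewrite !scale_conj_diag mxexpD // scalerDl.
Qed.

Lemma sym_scale X t : sym X -> sym (t *: X).
Proof. by rewrite /sym /= linearZ /= => ->. Qed.

Lemma exp_velocity (y : R) : t^-1 * (expR (t * y) - 1) @[t --> 0^'+] --> y.
Proof.
have dy : is_derive (0 : R) 1 (fun t : R => expR (t * y)) y.
  have dg : is_derive (0 : R) 1 (fun t : R => t * y) y.
    by apply: is_derive_eq; rewrite scaler0 add0r; exact: mulr1.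
  have de : is_derive ((fun t : R => t * y) 0) 1 (@expR R) 1.
    by rewrite mul0r -[X in is_derive _ _ _ X](@expR0 R); exact: is_derive_expR.
  by have := @is_derive1_comp _ expR (fun t => t * y) 0 _ _ de dg; rewrite mul1r.
have dl : h^-1 *: (expR ((h *: 1 + 0) * y) - expR (0 * y)) @[h --> (0 : R)^'] --> y.
  by rewrite -[X in _ --> X](@derive_val _ _ _ _ _ _ _ dy); exact: (@ex_derive _ _ _ _ _ _ _ dy).
apply: (cvg_near_eq (cvg_dnbhs_at_right dl)).
by near=> h; rewrite mul0r expR0 addr0 [h *: 1]mulr1.
Unshelve. all: by end_near. Qed.

Section Curve.
Variables (S X : 'M[R]_d).
Hypotheses (S_sym : sym S) (S_unit : S \in unitmx) (X_sym : sym X).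

Definition geodesic (t : R) : 'M[R]_d := S *m mxexp (t *: X) *m S.

Lemma geodesic_spd t : spd (geodesic t).
Proof.
rewrite /geodesic -[X in _ *m X]S_sym; apply: spd_congr => //.
by apply: spd_exp; exact: sym_scale.
Qed.

Lemma invmx_geodesic t :
  invmx (geodesic t) = invmx S *m mxexp ((- t) *: X) *m invmx S.
Proof.
apply: invmx_left; rewrite /geodesic !mulmxA mulmxKV //.
rewrite -(mulmxA (invmx S)) mxexp_addZ // addNr scale0r mxexp0 mulmx1.
exact: mulVmx.
Qed.

(** [geodesic a] and [geodesic b] are conjugate, by the same factor, to commuting
    exponentials, so that their relative spectrum is that of
    [exp ((b - a) *: X)]. *)
Lemma geodesic_geodesic_segment : geodesic_segment geodesic.
Proof.
split=> [t _|s t _ _]; first exact: geodesic_spd.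
have [U [x [oU XU]]] := symmetric_spectral X_sym.
have dE a b : dAI (geodesic a) (geodesic b) = `|a - b| * Num.sqrt (frob x x).
  have cp : char_poly (invmx (geodesic a) *m geodesic b) =
      \prod_(i < d) ('X - ((map_mx expR ((b - a) *: x)) 0 i)%:P).
    rewrite -(char_poly_conj_diag _ oU) invmx_geodesic /geodesic !mulmxA mulmxKV //.
    rewrite -(mulmxA (invmx S)) mxexp_addZ // [LHS]char_poly_conj ?mulVmx //.
    by rewrite [- a + b]addrC XU scale_conj_diag /mxexp mxfunE.
  rewrite (dAI_char_poly (geodesic_spd a) (geodesic_spd b) cp).
  have -> : map_mx (@ln R) (map_mx expR ((b - a) *: x)) = (b - a) *: x.
    by apply/rowP => i; rewrite !mxE expRK.
  rewrite frobZl frobZr mulrA -expr2 sqrtrM ?sqr_ge0 // sqrtr_sqr.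
  by rewrite distrC.
by rewrite !dE sub0r normrN normr1 mul1r.
Qed.

Lemma geodesic0 : geodesic 0 = S *m S.
Proof. by rewrite /geodesic scale0r mxexp0 mulmx1. Qed.

Lemma geodesic_velocity :
  t^-1 *: (geodesic t - S *m S) @[t --> 0^'+] --> S *m X *m S.
Proof.
have [U [x [oU XU]]] := symmetric_spectral X_sym.
have E t : t^-1 *: (geodesic t - S *m S) =
    S *m (U *m diag_mx (\row_i (t^-1 * (expR (t * x 0 i) - 1))) *m U^T) *m S.
  have -> : \row_i (t^-1 * (expR (t * x 0 i) - 1)) =
      t^-1 *: (map_mx expR (t *: x) - const_mx 1).
    by apply/rowP => i; rewrite !mxE.
  have -> : S *m S = S *m (U *m diag_mx (const_mx 1) *m U^T) *m S.
    by rewrite diag_const_mx mulmx1 oU mulmx1.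
  rewrite /geodesic XU scale_conj_diag /mxexp mxfunE //.
  rewrite -mulmxBl -mulmxBr -mulmxBl -mulmxBr -raddfB.
  by rewrite scalemxAl scalemxAr scale_conj_diag.
under eq_fun do rewrite E.
apply: cvg_mulmx; last exact: cvg_cst.
apply: cvg_mulmx; first exact: cvg_cst.
rewrite XU; apply: cvg_mulmx; last exact: cvg_cst.
apply: cvg_mulmx; first exact: cvg_cst.
apply/cvg_mxP => i j; under eq_fun do rewrite !mxE.
rewrite [diag_mx x i j]mxE; case: (i == j).
  by under eq_fun do rewrite mulr1n; rewrite mulr1n; exact: exp_velocity.
by under eq_fun do rewrite mulr0n; rewrite mulr0n; exact: cvg_cst.
Qed.

End Curve.

Lemma invmx_sym S : sym S -> sym (invmx S).
Proof. by rewrite /sym /= trmx_inv => ->. Qed.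

Section Endpoints.
Variables (P P' : 'M[R]_d).
Hypotheses (P_spd : spd P) (P'_spd : spd P').

Let S := invmx (mxinvsqrt P).
Let X := mxlog (whiten P P').

Lemma sqrt_sym : sym S. Proof. exact/invmx_sym/mxinvsqrt_sym. Qed.

Lemma sqrt_unitmx : S \in unitmx.
Proof. by rewrite unitmx_inv; exact: mxinvsqrt_unitmx. Qed.

Lemma sqrt_sqr : S *m S = P.
Proof.
have Ku := mxinvsqrt_unitmx P_spd; have Pu := spd_unitmx P_spd.
rewrite -[RHS]invmxK -(mxinvsqrt_sqr P_spd) /S; apply/esym; apply: invmx_left.
by rewrite !mulmxA mulmxKV // mulVmx.
Qed.

Lemma geodesic_endpoint : geodesic S X 1 = P'.
Proof.
have Ku := mxinvsqrt_unitmx P_spd.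
rewrite /geodesic scale1r /X (mxlogK (spd_whiten P_spd P'_spd)) /whiten /S.
by rewrite !mulmxA mulVmx // mul1mx -mulmxA mulmxV // mulmx1.
Qed.

Lemma geodesic_midpoint :
  P *m invmx (geodesic S X 2^-1) *m P' = geodesic S X 2^-1.
Proof.
have Xs : sym X := mxlog_sym (spd_whiten P_spd P'_spd).
have Su := sqrt_unitmx.
rewrite -{1}sqrt_sqr -geodesic_endpoint invmx_geodesic // /geodesic.
rewrite !mulmxA mulmxK // mulmxKV //.
rewrite -(mulmxA S) mxexp_addZ //; congr (_ *m mxexp (_ *: _) *m _).
by field.
Qed.

Lemma geodesic_in F t : geodesically_convex F -> F P -> F P' -> 0 <= t <= 1 ->
  F (geodesic S X t).
Proof.
move=> Fc FP FP'; have Xs : sym X := mxlog_sym (spd_whiten P_spd P'_spd).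
apply: (Fc _ (geodesic_geodesic_segment sqrt_sym sqrt_unitmx Xs)).
  by rewrite geodesic0 sqrt_sqr.
by rewrite geodesic_endpoint.
Qed.

Lemma whiten_sqrt_conj Y : whiten P (S *m Y *m S) = Y.
Proof.
have Ku := mxinvsqrt_unitmx P_spd.
by rewrite /whiten /S !mulmxA mulmxV // mul1mx -mulmxA mulVmx // mulmx1.
Qed.

End Endpoints.

End Geodesics.

(** * Tangent spaces of embedded submanifolds *)

Section SmoothCurves.
Context {R : realType}.

Lemma derive_line (V W : normedModType R) (f : V -> W) (x w : V) (s t : R^o) :
  'D_s (fun t : R^o => f (x + t *: w)) t = 'D_(s *: w) f (x + t *: w).
Proof.
rewrite /derive; set g1 := fun h => h^-1 *: _; set g2 := fun h => h^-1 *: _.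
suff -> : g1 = g2 by [].
rewrite funeqE => h; rewrite /g1 /g2 /=; congr (_ *: (f _ - _)).
by rewrite scalerDl addrCA scalerA.
Qed.

(** Lines are affine, so that the iterated directional derivatives of [f] along a
    line are those of [f] itself, evaluated on the line. *)
Lemma Ck_on_line k (V W : normedModType R) (f : V -> W) (x w : V)
    (A : set V) (B : set R^o) :
  Ck_on k A f -> (forall t, B t -> A (x + t *: w)) ->
  Ck_on k B (fun t : R^o => f (x + t *: w)).
Proof.
have line_diff (t : R^o) : differentiable (fun t : R^o => x + t *: w) t.
  have dl : is_diff t ( *:%R^~ w : R^o -> V) ( *:%R^~ w) by exact: is_diff_scalel.
  have -> : (fun t : R^o => x + t *: w) = cst x + ( *:%R^~ w : R^o -> V) by [].
  apply: differentiableD; first exact: differentiable_cst.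
  by case: dl.
move=> + BA; elim: k f => [|k IH] f /=.
  move=> fc t Bt.
  exact: (@continuous_comp _ _ _ (fun t : R^o => x + t *: w) f t
    (differentiable_continuous (line_diff t)) (fc _ (BA _ Bt))).
move=> [fd fk]; split=> [t Bt|s].
  by apply: (differentiable_comp (line_diff t)); exact: fd (BA _ Bt).
rewrite (_ : 'D_s _ = fun t : R^o => ('D_(s *: w) f) (x + t *: w)); last first.
  by apply/funext => t; rewrite derive_line.
exact: (IH _ (fk (s *: w))).
Qed.

Lemma linear_mx_continuous m n p q (f : {linear 'M[R]_(m, n) -> 'M[R]_(p, q)}) :
  continuous f.
Proof.
move=> X; apply/(@cvg_mxP _ _ (nbhs X)) => a b.
have E Y : f Y a b = \sum_i \sum_j Y i j * f (delta_mx i j) a b.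
  rewrite {1}(matrix_sum_delta Y) linear_sum summxE; apply: eq_bigr => i _.
  rewrite linear_sum summxE; apply: eq_bigr => j _.
  by rewrite linearZ mxE.
rewrite E; under eq_fun do rewrite E.
apply: cvg_sumr => i _; apply: cvg_sumr => j _.
by apply: cvgM; [exact: coord_continuous|exact: cvg_cst].
Qed.

Lemma linear_mx_bounded m n p q (f : {linear 'M[R]_(m, n) -> 'M[R]_(p, q)}) :
  exists2 C, 0 < C & forall X, `|f X| <= C * `|X|.
Proof.
have := continuous_linear_bounded 0 (@linear_mx_continuous _ _ _ _ f 0).
move=> /linear_boundedP bf; near +oo_R => C.
exists C; first by near: C; exact: nbhs_pinfty_gt.
by near: C.
Unshelve. all: by end_near. Qed.

Lemma linear_injective_left_inverse k d (D : {linear 'rV[R]_k -> 'M[R]_d}) :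
  injective D -> exists L : {linear 'M[R]_d -> 'rV[R]_k}, forall w, L (D w) = w.
Proof.
move=> Di; pose M := lin1_mx (mxvec \o D).
have Mfree : row_free M.
  rewrite -kermx_eq0; apply/rowV0P => v /sub_kermxP.
  rewrite mul_rV_lin1 /= => Dv; apply: Di; rewrite linear0.
  by rewrite -[D v]mxvecK Dv linear0.
exists (mulmxr (pinvmx M) \o mxvec) => w /=.
rewrite -[mxvec (D w)](@mul_rV_lin1 _ _ _ (mxvec \o D)) -/M.
by rewrite -mulmxA mulmxVp // mulmx1.
Qed.

Lemma differentiable_near (V W : normedModType R) (f : V -> W) (x : V) (e : R) :
  differentiable f x -> 0 < e ->
  \forall y \near x, `|f y - f x - 'd f x (y - x)| <= e * `|y - x|.
Proof.
move=> fd e0; have /eqaddoP/(_ e e0) := diff_locally fd.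
move=> H; apply/nbhs0P; apply: filterS H => h.
by rewrite /= !fctE /= [x + h]addrC addrK opprD addrA.
Qed.

Lemma remainder_le (C t e' e u a h r : R) : 0 < C -> 0 < t -> 0 <= e' -> 0 <= h ->
  r <= e' * h -> a <= t * (u + 1) -> h <= C * (a + r) ->
  e' * (2 * C) <= 1 -> e' * (2 * C * (u + 1)) <= e -> r <= t * e.
Proof.
move=> C0 t0 e'0 h0 rh au hC e'C e'B.
have Ca : C * a <= C * (t * (u + 1)) by rewrite ler_pM2l.
have Cr : C * r <= C * (e' * h) by rewrite ler_pM2l.
have hh := ler_wpM2r h0 e'C.
have h2 : h <= 2 * C * (u + 1) * t by lra.
apply: (le_trans rh); apply: (le_trans (ler_wpM2l e'0 h2)).
by rewrite mulrA mulrC ler_pM2l.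
Qed.

(** The velocity at [0] of a curve of [f @` W], known on one side only and
    without a derivative of its lift [x], is still in the range of ['d f]: a
    left inverse of ['d f] bounds the lift, whence the remainder is [o(t)]. *)
Lemma immersion_velocity k d (f : 'rV[R]_k -> 'M[R]_d) (x0 : 'rV[R]_k)
    (x : R -> 'rV[R]_k) (U : 'M[R]_d) :
  differentiable f x0 -> injective ('d f x0) ->
  x t @[t --> 0^'+] --> x0 ->
  t^-1 *: (f (x t) - f x0) @[t --> 0^'+] --> U ->
  exists w, U = 'd f x0 w.
Proof.
move=> fd Di xx0 QU; set D := 'd f x0 in Di *.
have [L LD] := linear_injective_left_inverse Di.
have [C C0 LC] := linear_mx_bounded L.
pose r t := f (x t) - f x0 - D (x t - x0).
have r0 : t^-1 *: r t @[t --> 0^'+] --> (0 : 'M[R]_d).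
  apply/cvgr0Pnorm_le => e e0.
  pose B := 2 * C * (`|U| + 1).
  have B0 : 0 < B by rewrite !mulr_gt0 // ltr_wpDl.
  pose e' := Num.min ((2 * C)^-1) (e / B).
  have C20 : 0 < 2 * C by rewrite mulr_gt0.
  have e'0 : 0 < e' by rewrite lt_min invr_gt0 C20 divr_gt0.
  have e'C : e' * (2 * C) <= 1.
    by rewrite -ler_pdivlMr // mul1r /e' ge_min lexx.
  have e'B : e' * B <= e by rewrite -ler_pdivlMr // /e' ge_min lexx orbT.
  have U1 : `|U| < `|U| + 1 by rewrite ltrDl.
  near=> t.
  have t0 : 0 < t by near: t; exact: nbhs_right_gt.
  have rt : `|r t| <= e' * `|x t - x0|.
    by near: t; exact: (xx0 _ (differentiable_near fd e'0)).
  have Qt : `|t^-1 *: (f (x t) - f x0)| <= `|U| + 1.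
    by near: t; exact: (cvgr_norm_le _ QU _ U1).
  have ft : `|f (x t) - f x0| <= t * (`|U| + 1).
    by move: Qt; rewrite normrZ gtr0_norm ?invr_gt0 // ler_pdivrMl.
  have ht : `|x t - x0| <= C * (`|f (x t) - f x0| + `|r t|).
    rewrite -{1}(LD (x t - x0)); apply: le_trans (LC _) _.
    rewrite ler_wpM2l ?(ltW C0) //.
    have -> : 'd f x0 (x t - x0) = (f (x t) - f x0) - r t by rewrite /r subKr.
    exact: ler_normB.
  rewrite normrZ gtr0_norm ?invr_gt0 // ler_pdivrMl //.
  exact: (remainder_le C0 t0 (ltW e'0) (normr_ge0 _) rt ft ht e'C e'B).
pose w := L U; exists w.
have DhU : D (t^-1 *: (x t - x0)) @[t --> 0^'+] --> U.
  have H : t^-1 *: (f (x t) - f x0) - t^-1 *: r t @[t --> 0^'+] --> U.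
    by rewrite -[U]subr0; exact: (cvgB QU r0).
  apply: (cvg_near_eq H); near=> t.
  by rewrite -scalerBr /r subKr linearZ.
have hw : t^-1 *: (x t - x0) @[t --> 0^'+] --> w.
  have H := cvg_comp _ _ DhU (@linear_mx_continuous _ _ _ _ L U).
  by apply: (cvg_near_eq H); near=> t; rewrite /= LD.
have H := cvg_comp _ _ hw (@linear_mx_continuous _ _ _ _ D w).
exact: (cvg_unique (@norm_hausdorff _ _) DhU H).
Unshelve. all: by end_near. Qed.

End SmoothCurves.

Section TangentSpace.
Context {R : realType} {d : nat}.
Implicit Types (F : set 'M[R]_d) (G U : 'M[R]_d).

Lemma tangent_velocity F G U : tangent F G U -> exists c : R -> 'M[R]_d,
  (\forall t \near 0^'+, F (c t)) /\ t^-1 *: (c t - G) @[t --> 0^'+] --> U.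
Proof.
move=> [c [e [e0 csm Fc c0 cU]]]; exists c; split.
  near=> t; apply: Fc; rewrite ger0_norm; first by near: t; exact: nbhs_right_lt.
  by apply: ltW; near: t; exact: nbhs_right_gt.
have cd : derivable c 0 1.
  by have [cd _] := csm 1%N; apply: diff_derivable; apply: cd; rewrite /= normr0.
have H : h^-1 *: ((c \o shift 0) (h *: 1) - c 0) @[h --> (0 : R)^'] --> U.
  by rewrite -cU; exact: cd.
apply: (cvg_near_eq (cvg_dnbhs_at_right H)); near=> h.
by rewrite /= addr0 [h *: 1]mulr1 c0.
Unshelve. all: by end_near. Qed.

(** The tangent space is the range of the derivative of a parametrization, and
    one-sided velocities already belong to it. *)
Lemma tangent_space k F G : embedded_submanifold k F -> F G ->
  exists D : {linear 'rV[R]_k -> 'M[R]_d},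
    (forall w, tangent F G (D w)) /\
    (forall (c : R -> 'M[R]_d) U, (\forall t \near 0^'+, F (c t)) ->
      t^-1 *: (c t - G) @[t --> 0^'+] --> U -> exists w, U = D w).
Proof.
move=> Fsub FG; have [N [W [f [g [[oN NG] [oW fW] [fsm fi] gf gc]]]]] := Fsub G FG.
have lift y : F y -> N y -> W (g y) /\ f (g y) = y.
  move=> Fy Ny; have : (f @` W) y by rewrite fW.
  by move=> [x Wx <-]; rewrite gf.
pose x0 := g G; have [Wx0 fx0] := lift G FG NG.
have fd x : W x -> differentiable f x by have [fd _] := fsm 1%N; exact: fd.
exists ('d f x0); split=> [w|c U Fc cU].
  have [e e0 eW] : exists2 e : R, 0 < e & forall t : R^o, `|t| < e -> W (x0 + t *: w).
    have cl : (fun t : R^o => x0 + t *: w) t @[t --> (0 : R^o)] --> x0.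
      rewrite -[X in _ --> X]addr0 -(scale0r w).
      by apply: cvgD; [exact: cvg_cst|apply: cvgZr_tmp; exact: cvg_id].
    have /nbhs_ballP[e e0 eW] := cl _ (open_nbhs_nbhs (conj oW Wx0)).
    by exists e => // t te; apply: eW; rewrite /ball /= sub0r normrN.
  exists (fun t : R^o => f (x0 + t *: w)), e; split=> //.
  - by move=> n; exact: (Ck_on_line (fsm n) eW).
  - move=> t te; have : (f @` W) (f (x0 + t *: w)) by exists (x0 + t *: w) => //; exact: eW.
    by rewrite fW => -[].
  - by rewrite scale0r addr0.
  - by rewrite derive_line scale1r scale0r addr0 deriveE //; exact: fd.
have cG := velocity_cvg cU.
have Nc : \forall t \near 0^'+, N (c t) by exact: (cG _ (open_nbhs_nbhs (conj oN NG))).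
apply: (@immersion_velocity _ _ _ f x0 (g \o c)).
- exact: fd.
- exact: fi.
- have /subspace_continuousP/(_ G (conj FG NG)) gG := gc.
  apply: cvg_trans gG => A /= wA.
  have cA : \forall t \near 0^'+, (F `&` N) (c t) -> A (g (c t)) by exact: (cG _ wA).
  suff : \forall t \near 0^'+, A (g (c t)) by [].
  near=> t; have : (F `&` N) (c t) by split; near: t.
  by near: t.
- rewrite fx0; apply: (cvg_near_eq cU); near=> t.
  by rewrite /= (lift (c t) _ _).2 //; near: t.
Unshelve. all: by end_near. Qed.

End TangentSpace.

(** * First-order variation of the objective *)

Section SpectralConvexity.
Context {R : realType} {d : nat} (phi : 'rV[R]_d -> R).
Hypotheses (phi_convex : convex phi) (phi_sym : permutation_invariant phi).

(** A function with a subgradient at every point is convex. *)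
Lemma spectral_convex (X Y : 'M[R]_d) (t : R) : sym X -> sym Y -> 0 <= t <= 1 ->
  phi (eigvals (t *: X + (1 - t) *: Y)) <=
  t * phi (eigvals X) + (1 - t) * phi (eigvals Y).
Proof.
move=> Xs Ys /andP[t0 t1]; set M := t *: X + _.
have Ms : sym M by rewrite /sym /= linearD !linearZ /= Xs Ys.
have [Z [_ ZM]] := spectral_subgradient_exists phi_convex phi_sym Ms.
have t1' : 0 <= 1 - t by rewrite subr_ge0.
have E : t * frob Z (X - M) + (1 - t) * frob Z (Y - M) = 0.
  by rewrite /M !frobBr !frobDr !frobZr; ring.
apply: le_trans (lerD (ler_wpM2l t0 (ZM X Xs)) (ler_wpM2l t1' (ZM Y Ys))).
rewrite !mulrDr addrACA E addr0 -mulrDl addrC subrK mul1r.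
exact: lexx.
Qed.

End SpectralConvexity.

Section CompositeConvexity.
Context {R : realType} {q : nat} (rho : 'rV[R]_q -> R).
Hypotheses (rho_convex : convex rho) (rho_mono : coordinatewise_nondecreasing rho).

Lemma subgradient_ge0 (x theta : 'rV[R]_q) :
  (forall y, rho x + frob theta (y - x) <= rho y) -> forall a, 0 <= theta 0 a.
Proof.
move=> tx a; have := tx (x - delta_mx 0 a).
have -> : frob theta (x - delta_mx 0 a - x) = - theta 0 a.
  rewrite addrAC subrr add0r frobNr frob_rV (bigD1 a) //= big1 ?addr0.
    by rewrite !mxE !eqxx mulr1.
  by move=> j ja; rewrite !mxE (negPf ja) mulr0.
have : rho (x - delta_mx 0 a) <= rho x.
  apply: (rho_mono (i := a)); last by rewrite !mxE !eqxx gerBl.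
  by move=> j ja; rewrite !mxE (negPf ja) subr0.
move: (rho _) (rho _) (theta _ _) => u v w; lra.
Qed.

Lemma nondecreasing_rho (x y : 'rV[R]_q) :
  (forall a, x 0 a <= y 0 a) -> rho x <= rho y.
Proof.
move=> xy; have [theta tx] := subgradient_exists x rho_convex.
apply: le_trans (tx y); rewrite lerDl frob_rV; apply: sumr_ge0 => a _.
by rewrite mulr_ge0 ?(subgradient_ge0 tx) // !mxE subr_ge0.
Qed.

End CompositeConvexity.

Section FirstOrderConditions.
Context {R : realType} {d q : nat}.
Variables (F : set 'M[R]_d) (H : 'I_q -> 'M[R]_d) (phi : 'I_q -> 'rV[R]_d -> R).
Variable rho : 'rV[R]_q -> R.
Hypotheses (H_spd : forall a, spd (H a)) (phi_convex : forall a, convex (phi a)).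
Hypotheses (phi_sym : forall a, permutation_invariant (phi a)).
Hypotheses (rho_convex : convex rho) (rho_mono : coordinatewise_nondecreasing rho).
Implicit Types (G : 'M[R]_d).

Local Notation L G a := (mxlog (whiten G (H a))).

Let L_sym G a : spd G -> sym (L G a).
Proof. by move=> Gs; apply: mxlog_sym; exact: (spd_whiten Gs (H_spd a)). Qed.

Lemma OmegasE G : spd G -> Omegas phi H G = \row_a phi a (eigvals (L G a)).
Proof.
move=> Gs; apply/rowP => a; rewrite !mxE.
exact: (Omega_mxlog (phi_sym a) Gs (H_spd a)).
Qed.

(** Monotonicity makes the multipliers nonnegative, hence the subgradient
    inequality of [rho] can be combined with those of the spectral functions. *)
Lemma objective_subgradient G G' (theta : 'rV[R]_q) (Z : 'I_q -> 'M[R]_d) :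
  spd G -> spd G' -> subdifferential setT rho (Omegas phi H G) theta ->
  (forall a, spectral_subdiff (phi a) (H a) G (Z a)) ->
  rho (Omegas phi H G) - \sum_a theta 0 a * frob (Z a) (mxlog (whiten G G')) <=
  rho (Omegas phi H G').
Proof.
move=> Gs Gs' [_ tG] ZG; have tG' y : rho _ + frob theta (y - _) <= rho y := tG y I.
have t0 := subgradient_ge0 rho_mono tG'.
apply: le_trans (tG' (Omegas phi H G')); rewrite lerD2l frob_rV -sumrN.
apply: ler_sum => a _; rewrite -mulrN ler_wpM2l // !mxE.
have := Omega_subgradient (phi_sym a) (H_spd a) Gs Gs' (ZG a).
by rewrite lerBrDl.
Qed.

(** Optimality at [G] seen from a nearby point [G1]. The subgradients are taken at
    [G1] and do not occur in the conclusion: [G1] can tend to [G] without a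
    compactness argument for the subgradients, by continuity of [rho] and of the
    spectral functions alone. *)
Lemma first_order_step G G1 (s : R) : spd G -> spd G1 -> 0 <= s ->
  rho (Omegas phi H G) <= rho (Omegas phi H G1) ->
  rho (Omegas phi H G1) <=
  rho (\row_a phi a (eigvals (L G1 a + s *: mxlog (whiten G1 G)))).
Proof.
move=> Gs Gs1 s0 GG1; set X := mxlog _.
have Xs : sym X by exact: mxlog_sym (spd_whiten Gs1 Gs).
have /choice[Z ZG] a : exists Z, spectral_subdiff (phi a) (H a) G1 Z.
  exact: (spectral_subgradient_exists (phi_convex a) (phi_sym a) (L_sym a Gs1)).
have [theta tG] := subgradient_exists (Omegas phi H G1) rho_convex.
have t0 := subgradient_ge0 rho_mono tG.
have sub : subdifferential setT rho (Omegas phi H G1) theta by split=> // y _.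
have tX : 0 <= \sum_a theta 0 a * frob (Z a) X.
  have := objective_subgradient Gs1 Gs sub ZG; rewrite -/X => H1.
  by move: (le_trans H1 GG1); rewrite gerBl.
apply: le_trans (tG _); rewrite lerDl frob_rV.
apply: le_trans (mulr_ge0 s0 tX) _; rewrite mulr_sumr; apply: ler_sum => a _.
rewrite mulrCA ler_wpM2l // OmegasE // !mxE.
have [_ ZGa] := ZG a; have := ZGa (L G1 a + s *: X).
rewrite -/(L G1 a) [L G1 a + _]addrC addrK frobZr lerBrDl; apply.
by rewrite /sym /= linearD linearZ /= Xs (L_sym a Gs1).
Qed.

Lemma cvg_row {T : Type} {FT : set_system T} {FF : Filter FT}
    (f : 'I_q -> T -> R) (l : 'I_q -> R) :
  (forall a, f a t @[t --> FT] --> l a) ->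
  (\row_a f a t) @[t --> FT] --> \row_a l a.
Proof.
move=> fl; apply/cvg_mxP => i a; rewrite mxE.
by under eq_fun do rewrite mxE; exact: fl.
Qed.

Lemma whiten_self G : spd G -> whiten G G = 1%:M.
Proof.
move=> Gs; have Ku := mxinvsqrt_unitmx Gs; have Gu := spd_unitmx Gs.
apply: (can_inj (mulKmx Ku)).
by rewrite /whiten !mulmxA mxinvsqrt_sqr // mulVmx // mul1mx mulmx1.
Qed.

Lemma whiten_velocity G (c : R -> 'M[R]_d) (U : 'M[R]_d) : spd G ->
  (\forall t \near 0^'+, spd (c t)) ->
  t^-1 *: (c t - G) @[t --> 0^'+] --> U ->
  t^-1 *: mxlog (whiten (c t) G) @[t --> 0^'+] --> - whiten G U.
Proof.
move=> Gs cs cU; have cG := velocity_cvg cU.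
have csym : \forall t \near 0^'+, sym (c t) by apply: filterS cs => t [].
have KK : mxinvsqrt (c t) @[t --> 0^'+] --> mxinvsqrt G by exact: mxinvsqrt_cvg.
apply: mxlog_velocity.
  by apply: filterS cs => t ct; case: (spd_whiten ct Gs).
have lim : mxinvsqrt (c t) *m (- (t^-1 *: (c t - G))) *m mxinvsqrt (c t)
    @[t --> 0^'+] --> mxinvsqrt G *m (- U) *m mxinvsqrt G.
  have nU : - (t^-1 *: (c t - G)) @[t --> 0^'+] --> - U by exact: cvgN cU.
  exact: (cvg_mulmx (cvg_mulmx KK nU) KK).
have -> : - whiten G U = mxinvsqrt G *m (- U) *m mxinvsqrt G.
  by rewrite mulmxN mulNmx.
apply: (cvg_near_eq lim); near=> t.
have ct : spd (c t) by near: t.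
rewrite -(whiten_self ct) /whiten -mulmxBl -mulmxBr scalemxAl scalemxAr.
by rewrite -scalerN opprB.
Unshelve. all: by end_near. Qed.

(** Minimality along the curves of [F] passes to the tangent space, where the
    objective is replaced by a convex function: divide [first_order_step] at
    [c t] by [t], that is take [s = t^-1], and let [t] tend to [0]. *)
Lemma tangent_variation G V : F `<=` spd ->
  minimizes_over F (fun G' => rho (Omegas phi H G')) G ->
  whitened_tangent F G V ->
  rho (Omegas phi H G) <= rho (\row_a phi a (eigvals (L G a - V))).
Proof.
move=> Fspd [FG Gmin] [U /tangent_velocity[c [Fc cU]] <-].
have Gs := Fspd G FG; have cG := velocity_cvg cU.
have cs : \forall t \near 0^'+, spd (c t) by apply: filterS Fc => t; exact: Fspd.
have csym : \forall t \near 0^'+, sym (c t) by apply: filterS cs => t [].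
have KK : mxinvsqrt (c t) @[t --> 0^'+] --> mxinvsqrt G by exact: mxinvsqrt_cvg.
have cX := whiten_velocity Gs cs cU.
have Xsym : \forall t \near 0^'+, sym (t^-1 *: mxlog (whiten (c t) G)).
  apply: filterS cs => t ct; apply: sym_scale.
  exact: mxlog_sym (spd_whiten ct Gs).
have Lc a : L (c t) a @[t --> 0^'+] --> L G a.
  apply: mxlog_cvg; first exact: spd_whiten.
    by apply: filterS cs => t ct; case: (spd_whiten ct (H_spd a)).
  exact: (cvg_mulmx (cvg_mulmx KK (cvg_cst (H a))) KK).
have Vsym : sym (whiten G U).
  have Vs : sym (- whiten G U) by exact: sym_cvg Xsym cX.
  by move: Vs; rewrite /sym /= linearN /= => /oppr_inj.
have rho_cont := convex_continuous rho_convex.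
have lim1 : rho (\row_a phi a (eigvals (L (c t) a))) @[t --> 0^'+] -->
    rho (\row_a phi a (eigvals (L G a))).
  apply: (cvg_comp _ rho) (rho_cont _); apply: cvg_row => a.
  apply: (spectral_function_cvg (phi_convex a) (phi_sym a) (L_sym a Gs)).
    by apply: filterS cs => t; exact: L_sym.
  exact: Lc.
have lim2 : rho (\row_a phi a (eigvals (L (c t) a + t^-1 *: mxlog (whiten (c t) G))))
    @[t --> 0^'+] --> rho (\row_a phi a (eigvals (L G a - whiten G U))).
  apply: (cvg_comp _ rho) (rho_cont _); apply: cvg_row => a.
  apply: (spectral_function_cvg (phi_convex a) (phi_sym a)).
  - by rewrite /sym /= linearB /= (L_sym a Gs) Vsym.
  - near=> t; have ct : spd (c t) by near: t.
    have Xt : sym (t^-1 *: mxlog (whiten (c t) G)) by near: t.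
    by rewrite /sym /= linearD /= (L_sym a ct) Xt.
  - exact: (cvgD (Lc a) cX).
rewrite (OmegasE Gs); apply: (ler_cvg_to lim1 lim2).
near=> t; have ct : spd (c t) by near: t.
have t0 : 0 < t by near: t; exact: nbhs_right_gt.
rewrite -(OmegasE ct); apply: (first_order_step Gs ct).
  by rewrite invr_ge0 ltW.
by apply: Gmin; near: t.
Unshelve. all: by end_near. Qed.

End FirstOrderConditions.

(** * Multipliers and the minimality criterion *)

Section LagrangeMultipliers.
Context {R : realType} {d q : nat}.
Variables (F : set 'M[R]_d) (H : 'I_q -> 'M[R]_d) (phi : 'I_q -> 'rV[R]_d -> R).
Variable rho : 'rV[R]_q -> R.
Hypotheses (H_spd : forall a, spd (H a)) (phi_convex : forall a, convex (phi a)).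
Hypotheses (phi_sym : forall a, permutation_invariant (phi a)).
Hypotheses (rho_convex : convex rho) (rho_mono : coordinatewise_nondecreasing rho).
Implicit Types (G : 'M[R]_d).

Local Notation L G a := (mxlog (whiten G (H a))).

Let L_sym G a : spd G -> sym (L G a).
Proof. by move=> Gs; apply: mxlog_sym; exact: (spd_whiten Gs (H_spd a)). Qed.

Let symm (W : 'M[R]_d) := 2^-1 *: (W + W^T).

Let symm_sym W : sym (symm W).
Proof. by rewrite /symm /sym /= linearZ /= linearD /= trmxK addrC. Qed.

Let symm_id W : sym W -> symm W = W.
Proof.
move=> Ws; have -> : symm W = 2^-1 *: (2 *: W).
  by rewrite /symm (Ws : W^T = W) scaler_nat mulr2n.
by rewrite scalerA mulVf ?pnatr_eq0 // scale1r.
Qed.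

Let frob_symm V W : sym W -> frob (symm V) W = frob V W.
Proof.
move=> Ws; rewrite /symm frobZl frobDl -[X in _ + frob _ X]trmxK frob_tr.
by rewrite (Ws : W^T = W); field.
Qed.

Let uu (E : 'M[R]_(q, 1 + d * d)) a := E a (lshift _ 0).
Let WW (E : 'M[R]_(q, 1 + d * d)) a := vec_mx (rsubmx (row a E)).
Let pack (u : 'rV[R]_q) (W : 'I_q -> 'M[R]_d) : 'M[R]_(q, 1 + d * d) :=
  \matrix_a row_mx (u 0 a)%:M (mxvec (W a)).

Let uu_pack u W a : uu (pack u W) a = u 0 a.
Proof. by rewrite /uu mxE row_mxEl mxE eqxx mulr1n. Qed.

Let WW_pack u W a : WW (pack u W) a = W a.
Proof. by rewrite /WW rowK row_mxKr mxvecK. Qed.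

Let frob_pack E u W : frob E (pack u W) =
  \sum_a (uu E a * u 0 a + frob (WW E a) (W a)).
Proof.
rewrite frob_row; apply: eq_bigr => a _.
rewrite frob_rV big_split_ord /= big_ord1; congr (_ + _).
  by rewrite rowK row_mxEl !mxE eqxx mulr1n.
rewrite frob_mxvec /WW vec_mxK frob_rV; apply: eq_bigr => j _.
by rewrite rowK row_mxEr !mxE.
Qed.

(** Linearization of [(u, W) |-> rho (phi (L + W) + u)] along the diagonal
    [(0, (X, .., X))]: the gradient in [u] is [theta], and the gradient in [W a]
    is [theta a] times a subgradient of the [a]-th spectral function. *)
Lemma lagrange_multipliers G k (D : {linear 'rV[R]_k -> 'M[R]_d}) : spd G ->
  (forall w, sym (D w)) ->
  (forall w, rho (Omegas phi H G) <= rho (\row_a phi a (eigvals (L G a + D w)))) ->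
  exists (theta : 'rV[R]_q) (Z : 'I_q -> 'M[R]_d),
    [/\ subdifferential setT rho (Omegas phi H G) theta,
        forall a, spectral_subdiff (phi a) (H a) G (Z a)
      & forall w, frob (\sum_a theta 0 a *: Z a) (D w) = 0].
Proof.
move=> Gs Ds Dmin.
pose Psi (u : 'rV[R]_q) (W : 'I_q -> 'M[R]_d) :=
  rho (\row_a (phi a (eigvals (L G a + W a)) + u 0 a)).
pose p E := Psi (\row_a uu E a) (fun a => symm (WW E a)).
have LW_sym a W : sym W -> sym (L G a + W).
  by move=> Ws; rewrite /sym /= linearD /= (L_sym a Gs) Ws.
have pc : convex p.
  move=> E1 E2 t t01; rewrite /p /Psi; apply: le_trans (rho_convex _ _ t01).
  apply: (nondecreasing_rho rho_convex rho_mono) => a; rewrite !mxE /uu !mxE.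
  have -> : L G a + symm (WW (t *: E1 + (1 - t) *: E2) a) =
      t *: (L G a + symm (WW E1 a)) + (1 - t) *: (L G a + symm (WW E2 a)).
    by apply/matrixP => i j; rewrite /WW /symm !mxE; field.
  rewrite !mulrDr [leRHS]addrACA lerD2r.
  exact: (spectral_convex (phi_convex a) (phi_sym a) (LW_sym a _ (symm_sym (WW E1 a)))
            (LW_sym a _ (symm_sym (WW E2 a))) t01).
pose ones : 'cV[R]_q := const_mx 1.
pose Dq : {linear 'rV[R]_k -> 'M[R]_(q, 1 + d * d)} :=
  mulmx ones \o mulmxr (row_mx (0 : 'M[R]_(d * d, 1)) 1%:M) \o mxvec \o D.
have DqE w : Dq w = pack 0 (fun=> D w).
  apply/row_matrixP => a; rewrite rowK /Dq /= row_mul.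
  have -> : row a ones = 1%:M.
    by apply/matrixP => i j; rewrite !ord1 !mxE.
  rewrite mul1mx mul_mx_row mulmx0 mulmx1; congr row_mx.
  by apply/matrixP => i j; rewrite !mxE mul0rn.
have Psi0 : p 0 = rho (Omegas phi H G).
  rewrite /p /Psi (OmegasE H_spd phi_sym Gs); congr rho; apply/rowP => a; rewrite !mxE.
  have -> : WW 0 a = 0 by rewrite /WW !raddf0.
  by rewrite /symm trmx0 addr0 scaler0 addr0 /uu mxE addr0.
have p_pack u W : (forall a, sym (W a)) -> p (pack u W) = Psi u W.
  move=> Ws; rewrite /p /Psi; congr rho; apply/rowP => a; rewrite !mxE.
  by rewrite WW_pack uu_pack symm_id.
have pD w : p 0 <= p (Dq w).
  rewrite DqE p_pack // Psi0; apply: le_trans (Dmin w) _.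
  by rewrite le_eqVlt; apply/orP; left; apply/eqP; congr rho;
     apply/rowP => a; rewrite !mxE addr0.
have [Y [YE YD]] := matrix_subgradient pc pD.
pose theta : 'rV[R]_q := \row_a uu Y a.
pose V a := symm (WW Y a).
have key (u : 'rV[R]_q) (W : 'I_q -> 'M[R]_d) : (forall a, sym (W a)) ->
    rho (Omegas phi H G) + \sum_a (theta 0 a * u 0 a + frob (V a) (W a)) <= Psi u W.
  move=> Ws; have := YE (pack u W); rewrite Psi0 p_pack // frob_pack.
  congr (_ + _ <= _); apply: eq_bigr => a _.
  by rewrite mxE /V frob_symm.
have tG : subdifferential setT rho (Omegas phi H G) theta.
  split=> // y _; have := key (y - Omegas phi H G) (fun=> 0) (fun=> trmx0 _ _ _).
  rewrite frob_rV; under eq_bigr do rewrite frob0r addr0.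
  have -> : Psi (y - Omegas phi H G) (fun=> 0) = rho y; last by [].
  rewrite /Psi; congr rho; apply/rowP => a; rewrite (OmegasE H_spd phi_sym Gs) !mxE.
  by rewrite addr0 subrKC.
have tG' y : rho (Omegas phi H G) + frob theta (y - Omegas phi H G) <= rho y.
  by case: tG => _ tG1; exact: tG1.
have t0 := subgradient_ge0 rho_mono tG'.
have Vsub a W : sym W -> theta 0 a * phi a (eigvals (L G a)) + frob (V a) W <=
    theta 0 a * phi a (eigvals (L G a + W)).
  move=> Ws; pose Wa b := if b == a then W else 0.
  pose u : 'rV[R]_q := \row_b (if b == a then phi a (eigvals (L G a)) -
                                             phi a (eigvals (L G a + W)) else 0).
  have Was b : sym (Wa b) by rewrite /Wa; case: ifP => // _; exact: trmx0.
  have := key u Wa Was; have -> : Psi u Wa = rho (Omegas phi H G).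
    rewrite /Psi (OmegasE H_spd phi_sym Gs); congr rho; apply/rowP => b; rewrite !mxE /Wa.
    by case: eqVneq => [->|_]; rewrite ?subrKC // !addr0.
  rewrite gerDl (bigD1 a) //= big1 ?addr0 => [|b ba].
    by rewrite [u 0 a]mxE /Wa eqxx mulrBr addrAC subr_le0.
  by rewrite [u 0 b]mxE /Wa (negPf ba) mulr0 frob0r addr0.
have /choice[Z ZG] a : exists Z, spectral_subdiff (phi a) (H a) G Z /\ theta 0 a *: Z = V a.
  have [ta|ta] := eqVneq (theta 0 a) 0.
    have [Z Zs] := spectral_subgradient_exists (phi_convex a) (phi_sym a) (L_sym a Gs).
    exists Z; split=> //; rewrite ta scale0r; apply/esym/frob_eq0/eqP.
    rewrite eq_le frob_ge0 andbT.
    by have := Vsub a (V a) (symm_sym _); rewrite ta !mul0r add0r.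
  have tp : 0 < theta 0 a by rewrite lt0r ta t0.
  exists ((theta 0 a)^-1 *: V a); split; last by rewrite scalerA divff // scale1r.
  split=> [|X Xs]; first by apply: sym_scale; exact: symm_sym.
  have XLs : sym (X - L G a) by rewrite /sym /= linearB /= Xs (L_sym a Gs).
  have := Vsub a _ XLs; rewrite -/(L G a) subrKC => VX.
  rewrite -(ler_pM2l tp) mulrDr frobZl mulrA divff // mul1r.
  exact: VX.
exists theta, Z; split=> // [a|w]; first by case: (ZG a).
have YDw := YD w; rewrite DqE frob_pack in YDw.
rewrite frob_suml -[RHS]YDw; apply: eq_bigr => a _.
by case: (ZG a) => _ ->; rewrite [X in _ * X]mxE mulr0 add0r /V frob_symm.
Qed.

Lemma tangent_sym G U : F `<=` spd -> F G -> tangent F G U -> sym U.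
Proof.
move=> Fspd FG /tangent_velocity[c [Fc cU]].
apply: (sym_cvg _ cU); apply: filterS Fc => t /Fspd[cs _].
have [Gsym _] := Fspd G FG; apply: sym_scale.
by rewrite /sym /= linearB /= (cs : _^T = _) (Gsym : _^T = _).
Qed.

(** Sufficiency: the geodesic to a competitor lies in [F], so its whitened velocity
    is tangent and the subgradient inequality reduces to the objective values.
    Necessity: [tangent_variation] followed by [lagrange_multipliers]. *)
Lemma minimizer_criterion G : F `<=` spd -> geodesically_convex F ->
  (exists k, embedded_submanifold k F) -> F G ->
  minimizes_over F (fun G' => rho (Omegas phi H G')) G <->
  exists (theta : 'rV[R]_q) (Z : 'I_q -> 'M[R]_d),
    [/\ subdifferential setT rho (Omegas phi H G) theta,
        forall a, spectral_subdiff (phi a) (H a) G (Z a)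
      & whitened_normal F G (\sum_a theta 0 a *: Z a)].
Proof.
move=> Fspd Fconv [k Fsub] FG; have Gs := Fspd G FG.
have [D [Dtan Dvel]] := tangent_space Fsub FG.
split=> [Gmin|[theta [Z [tG ZG [_ ZN]]]]]; last first.
  split; first exact: FG.
  move=> G' FG'; have Gs' := Fspd G' FG'.
  apply: le_trans (objective_subgradient H_spd phi_sym rho_mono Gs Gs' tG ZG).
  pose S := invmx (mxinvsqrt G); pose X := mxlog (whiten G G').
  have [w Xw] : exists w, S *m X *m S = D w.
    apply: (Dvel (geodesic S X)).
      near=> t; apply: (geodesic_in Gs Gs' Fconv FG FG'); apply/andP; split.
        by apply: ltW; near: t; exact: nbhs_right_gt.
      by apply: ltW; near: t; apply: nbhs_right_lt.
    have Xs : sym X by exact: mxlog_sym (spd_whiten Gs Gs').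
    by have gv := geodesic_velocity Xs (S := S); rewrite (sqrt_sqr Gs) in gv.
  have XN : whitened_tangent F G X.
    by exists (D w) => //; rewrite -Xw; exact: whiten_sqrt_conj.
  have ZX : \sum_a theta 0 a * frob (Z a) X = 0.
    rewrite -[RHS](ZN X XN) frob_suml.
    by apply: eq_bigr => a _; rewrite frobZl.
  by rewrite -/X ZX subr0.
pose D' : {linear 'rV[R]_k -> 'M[R]_d} :=
  mulmxr (mxinvsqrt G) \o mulmx (mxinvsqrt G) \o D.
have D'E w : D' w = whiten G (D w) by [].
have D's w : sym (D' w).
  have Ds : (D w)^T = D w by exact: (tangent_sym Fspd FG (Dtan w)).
  rewrite D'E /whiten /sym /= !trmx_mul (mxinvsqrt_sym Gs) Ds.
  by rewrite !mulmxA.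
have D'min w : rho (Omegas phi H G) <=
    rho (\row_a phi a (eigvals (L G a + D' w))).
  have tw : whitened_tangent F G (- D' w).
    by exists (D (- w)); [exact: Dtan|rewrite -D'E linearN].
  have := tangent_variation H_spd phi_convex phi_sym rho_convex rho_mono Fspd Gmin tw.
  by under eq_mx do rewrite opprK.
have [theta [Z [tG ZG ZN]]] := lagrange_multipliers Gs D's D'min.
exists theta, Z; split=> //; split.
  rewrite /sym /= linear_sum; apply: eq_bigr => a _; rewrite linearZ /=.
  by case: (ZG a) => Zs _; rewrite (Zs : _^T = _).
move=> _ [U tU <-]; have [c [Fc cU]] := tangent_velocity tU.
by have [w ->] := Dvel c U Fc cU; rewrite -D'E.
Unshelve. all: by end_near. Qed.

End LagrangeMultipliers.

(** * Existence of the nearest point *)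

Section NearestPoint.
Context {R : realType} {d : nat}.
Implicit Types (F : set 'M[R]_d) (G H P X Z : 'M[R]_d).

Definition sqnorm (x : 'rV[R]_d) : R := frob x x.

Lemma sqnorm_convex : convex sqnorm.
Proof.
move=> x y t /andP[t0 t1]; rewrite /sqnorm.
have := mulr_ge0 (mulr_ge0 t0 (_ : 0 <= 1 - t)) (frob_ge0 (x - y)).
rewrite subr_ge0 => /(_ t1).
rewrite !frobBl !frobBr !frobDl !frobDr !frobZl !frobZr (frobC y x); lra.
Qed.

Lemma sqnorm_sym : permutation_invariant sqnorm.
Proof. exact: permutation_invariant_frob. Qed.

Lemma sqnorm_eigvals X : sym X -> sqnorm (eigvals X) = frob X X.
Proof.
move=> /symmetric_spectral[U [v [oU ->]]].
by rewrite (symmetric_eigvals v sqnorm_sym oU) frob_conjK // frob_diag_diag.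
Qed.

(** [whiten H G] and [whiten G H] have inverse spectra, and the squared norm does
    not see the sign of the logarithms. *)
Lemma dAI_Omega H G : spd H -> spd G -> dAI H G = Num.sqrt (Omega sqnorm H G).
Proof.
move=> Hs Gs; have [U [v [oU _ v0 E]]] := spd_spectral (spd_whiten Gs Hs).
have cH : char_poly (invmx H *m G) =
    \prod_(i < d) ('X - ((map_mx GRing.inv v) 0 i)%:P).
  have Ku := mxinvsqrt_unitmx Gs; have Hu := spd_unitmx Hs.
  rewrite -(char_poly_conj_diag _ oU) -(invmx_conj_diag oU v0) -E.
  have -> : invmx (whiten G H) =
      invmx (mxinvsqrt G) *m invmx H *m invmx (mxinvsqrt G).
    apply: invmx_left; rewrite /whiten !mulmxA mulmxKV //.
    by rewrite -(mulmxA _ (invmx H)) mulVmx // mulmx1 mulVmx.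
  rewrite -[RHS](char_poly_conj _ (mulmxV Ku)) !mulmxA mulmxV // mul1mx.
  by rewrite -mulmxA sqrt_sqr.
rewrite (dAI_char_poly Hs Gs cH); congr Num.sqrt.
rewrite /Omega E (symmetric_fun_eigvals _ sqnorm_sym (char_poly_conj_diag v oU)).
have -> : map_mx (@ln R) (map_mx GRing.inv v) = - map_mx (@ln R) v.
  by apply/rowP => i; rewrite !mxE lnV // posrE.
by rewrite frobNl frobNr opprK.
Qed.

Lemma nearest_pointP F H P : spd H -> F `<=` spd ->
  nearest_point F H P <-> minimizes_over F (Omega sqnorm H) P.
Proof.
move=> Hs Fspd; have O0 G : 0 <= Omega sqnorm H G by exact: frob_ge0.
have E G : F P -> F G ->
    (dAI H P <= dAI H G) = (Omega sqnorm H P <= Omega sqnorm H G).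
  move=> FP FG; rewrite (dAI_Omega Hs (Fspd P FP)) (dAI_Omega Hs (Fspd G FG)).
  by rewrite (ler_sqrt _ (O0 G)).
split=> -[FP Pmin]; split; try exact: FP; move=> G FG; have := Pmin G FG.
  by rewrite (E G FP FG).
by rewrite (E G FP FG).
Qed.

Lemma closed_min_norm n (C : set 'rV[R]_n) : closed C -> C !=set0 ->
  exists2 x, C x & forall y, C y -> frob x x <= frob y y.
Proof.
move=> Ccl [x1 Cx1]; pose K := C `&` [set x : 'rV[R]_n | frob x x <= frob x1 x1].
have nc : continuous (fun x : 'rV[R]_n => frob x x).
  by move=> x; apply: (@cvg_frob _ _ (nbhs x) _ _ _ id id); exact: cvg_id.
have Kc : compact K.
  apply: bounded_closed_compact.
    exists (1 + frob x1 x1); split=> [|M M1 x [_ xx1]]; first exact: num_real.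
    apply: le_trans (ltW M1).
    rewrite /Num.norm /= mx_normrE; apply/bigmax_leP; split=> [|[i j] _ /=].
      by rewrite addr_ge0 ?frob_ge0.
    have := le_trans (frob_coord_le x i j) xx1; have := frob_ge0 x1.
    move: (frob x1 x1) (x i j) => b a b0 ab.
    rewrite ler_norml; apply/andP; split; clear -ab b0; nra.
  apply: closedI => //.
  rewrite (_ : [set x | _] = (fun x : 'rV[R]_n => frob x x) @^-1` [set r | r <= frob x1 x1]) //.
  by apply: preimage_closed; [move=> x _; exact: nc|exact: closed_le].
have [x /set_mem[Cx xx1] xmin] := compact_EVT_min (ex_intro _ x1 (conj Cx1 (lexx _)))
  Kc (continuous_subspaceT nc).
exists x => // y Cy; have [yx1|/ltW x1y] := leP (frob y y) (frob x1 x1).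
  by apply: xmin; apply/mem_set.
exact: le_trans xx1 x1y.
Qed.

(** In the coordinates [X |-> S *m mxexp X *m S] the distance to [H] is the norm
    of [X]: a closed set of symmetric matrices has an element of least norm. *)
Lemma nearest_point_exists F H : F !=set0 -> F `<=` spd -> closed_in_spd F ->
  spd H -> exists P, nearest_point F H P.
Proof.
move=> [P0 FP0] Fspd Fcl Hs; pose S := invmx (mxinvsqrt H).
have Ssym : sym S := sqrt_sym Hs; have Su : S \in unitmx := sqrt_unitmx Hs.
pose expH (X : 'M[R]_d) := S *m mxexp X *m S.
pose C := [set x : 'rV[R]_(d * d) | sym (vec_mx x) /\ F (expH (vec_mx x))].
have dE X : sym X -> dAI H (expH X) = Num.sqrt (frob X X).
  by move=> Xs; rewrite /dAI /fnorm /expH (whiten_sqrt_conj Hs) mxexpK.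
have CE P : F P -> C (mxvec (mxlog (whiten H P))) /\ expH (mxlog (whiten H P)) = P.
  move=> FP; have Ps := Fspd P FP.
  have E : expH (mxlog (whiten H P)) = P.
    by rewrite -[RHS](geodesic_endpoint Hs Ps) /geodesic scale1r.
  split=> //; split; rewrite mxvecK; first exact: mxlog_sym (spd_whiten Hs Ps).
  by rewrite E.
have vecc (y : 'rV[R]_(d * d)) : vec_mx x @[x --> y] --> vec_mx y.
  apply/(@cvg_mxP _ _ (nbhs y)) => i j; rewrite mxE; under eq_fun do rewrite mxE.
  exact: coord_continuous.
have Ccl : closed C.
  move=> y Cy; have fC : ProperFilter (within C (nbhs y)).
    apply: Build_ProperFilter_ex => A wA.
    by have [x [Cx Ax]] := Cy _ wA; exists x; exact: Ax.
  have vc : vec_mx x @[x --> within C (nbhs y)] --> vec_mx y.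
    exact: cvg_within_filter (vecc y).
  have vs : \forall x \near within C (nbhs y), sym (vec_mx x).
    by near=> x; have [] : C x by near: x; exact: withinT.
  have ys : sym (vec_mx y) by exact: sym_cvg vs vc.
  split; first exact: ys.
  have Fcl' : forall Q, (closure F `&` spd) Q -> F Q by exact: Fcl.
  apply: Fcl'; split; last first.
    by have := geodesic_spd Ssym Su ys 1; rewrite /geodesic scale1r.
  have ec : expH (vec_mx x) @[x --> within C (nbhs y)] --> expH (vec_mx y).
    have ec' : mxexp (vec_mx x) @[x --> within C (nbhs y)] --> mxexp (vec_mx y).
      exact: mxexp_cvg.
    exact: (cvg_mulmx (cvg_mulmx (cvg_cst S) ec') (cvg_cst S)).
  move=> B /ec wB; have [x [Cx Bx]] := Cy _ wB.
  by exists (expH (vec_mx x)); split; [case: Cx|exact: Bx].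
have C0 : C !=set0 by exists (mxvec (mxlog (whiten H P0))); case: (CE _ FP0).
have [x [xs Fx] xmin] := closed_min_norm Ccl C0.
exists (expH (vec_mx x)); split; first exact: Fx.
move=> P FP; have [CP <-] := CE P FP.
have Ps : sym (mxlog (whiten H P)) by exact: mxlog_sym (spd_whiten Hs (Fspd P FP)).
rewrite (dE _ xs) (dE _ Ps) ler_wsqrtr // frob_mxvec vec_mxK [leRHS]frob_mxvec.
exact: xmin.
Unshelve. all: by end_near. Qed.

End NearestPoint.

(** * Uniqueness of the nearest point and the theorem *)

Section Uniqueness.
Context {R : realType} {d : nat}.
Implicit Types (F : set 'M[R]_d) (A E H P X Z : 'M[R]_d).

Lemma char_poly_eq_trace n (A B : 'M[R]_n) :
  char_poly A = char_poly B -> \tr A = \tr B.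
Proof.
case: n A B => [|n] A B AB; first by rewrite /mxtrace !big_ord0.
by apply: oppr_inj; rewrite -!char_poly_trace // AB.
Qed.

Lemma spd_diag_gt0 A i : spd A -> 0 < A i i.
Proof.
move=> [_ Apos]; have e0 : (delta_mx 0 i : 'rV[R]_d) != 0.
  by apply/eqP => /rowP/(_ i)/eqP; rewrite !mxE !eqxx oner_eq0.
by have := Apos _ e0; rewrite -rowE trmx_delta -colE !mxE.
Qed.

Lemma inv_sum_ge (x : R) : 0 < x -> 0 <= x + x^-1 - 2.
Proof.
move=> x0; have -> : x + x^-1 - 2 = (x - 1) ^+ 2 / x by field; rewrite gt_eqF.
by rewrite divr_ge0 ?sqr_ge0 // ltW.
Qed.

Lemma inv_sum_eq (x : R) : 0 < x -> x + x^-1 - 2 = 0 -> x = 1.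
Proof.
move=> x0; have -> : x + x^-1 - 2 = (x - 1) ^+ 2 / x by field; rewrite gt_eqF.
move/eqP; rewrite mulf_eq0 invr_eq0 (gt_eqF x0) orbF sqrf_eq0 subr_eq0.
by move/eqP.
Qed.

(** The matrix [E + E^-1 - 2] is positive semidefinite, and vanishes only at
    [E = 1]. *)
Lemma trace_inv_eq1 A E : spd A -> spd E ->
  \tr (A *m E) = \tr A -> \tr (A *m invmx E) = \tr A -> E = 1%:M.
Proof.
move=> As Es; have [Q [e [oQ _ e0 EQ]]] := spd_spectral Es.
have Cs : spd (Q^T *m A *m Q).
  rewrite -{2}[Q]trmxK; apply: spd_congr => //.
  exact: orthogonal_unitmx (orthogonal_tr oQ).
have trE (x : 'rV[R]_d) : \tr (A *m (Q *m diag_mx x *m Q^T)) =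
    \sum_i x 0 i * (Q^T *m A *m Q) i i.
  case: As => As _; rewrite -frob_diag -frob_conj // frobC /frob.
  by rewrite (As : A^T = A).
have tr1 : \tr A = \sum_i (Q^T *m A *m Q) i i.
  have := trE (const_mx 1); rewrite diag_const_mx mulmx1 oQ mulmx1 => ->.
  by apply: eq_bigr => i _; rewrite mxE mul1r.
rewrite EQ (invmx_conj_diag oQ e0) !trE tr1 => h1 h2.
have h2' : \sum_i (e 0 i)^-1 * (Q^T *m A *m Q) i i = \sum_i (Q^T *m A *m Q) i i.
  by rewrite -h2; apply: eq_bigr => i _; rewrite [map_mx _ _ _ _]mxE.
have h0 : \sum_i (e 0 i + (e 0 i)^-1 - 2) * (Q^T *m A *m Q) i i = 0.
  under eq_bigr do rewrite mulrBl mulrDl.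
  rewrite sumrB big_split /= h1 h2' -mulr_sumr; ring.
have e1 i : e 0 i = 1.
  apply: inv_sum_eq => //; apply/eqP.
  have /eqP := h0; rewrite psumr_eq0 => [/allP/(_ i (mem_index_enum _))/=|j _].
    by rewrite mulf_eq0 (gt_eqF (spd_diag_gt0 i Cs)) orbF.
  by rewrite mulr_ge0 ?inv_sum_ge // ltW // spd_diag_gt0.
by rewrite conj_diag1.
Qed.

(** The squared distance to [H] is strictly convex on [F]: at the midpoint of two
    minimizers, the whitened spectra of [H] at the three points coincide, and
    comparing traces forces the two minimizers to be equal. *)
Lemma nearest_point_unique F H P P' : F `<=` spd -> geodesically_convex F ->
  spd H -> nearest_point F H P -> nearest_point F H P' -> P = P'.
Proof.
move=> Fspd Fconv Hs /(nearest_pointP _ Hs Fspd)[FP Pmin].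
move=> /(nearest_pointP _ Hs Fspd)[FP' P'min].
have Ps := Fspd P FP; have Ps' := Fspd P' FP'.
pose M := geodesic (invmx (mxinvsqrt P)) (mxlog (whiten P P')) 2^-1.
have FM : F M.
  by apply: (geodesic_in Ps Ps' Fconv FP FP'); rewrite invr_ge0 ler0n invf_le1 ?ler1n.
have Ms := Fspd M FM.
have mid : P *m invmx M *m P' = M by exact: geodesic_midpoint.
have Es : spd (whiten M P') := spd_whiten Ms Ps'.
have EE : invmx (whiten M P') = whiten M P.
  apply: invmx_left; rewrite -(whiten_self Ms) -[X in _ = whiten M X]mid.
  by rewrite /whiten -(mxinvsqrt_sqr Ms) !mulmxA.
set A := whiten M H; have As : spd A := spd_whiten Ms Hs.
pose L := mxlog A; have Ls : sym L := mxlog_sym As.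
have [U [l [oU ls LU]]] := sorted_spectral Ls.
pose V := mxlog (whiten M P'); have Vs : sym V := mxlog_sym Es.
have nVs : sym (- V) by rewrite /sym /= linearN /= (Vs : _^T = _).
have C1 : char_poly (whiten P' H) = char_poly (mxexp L *m mxexp (- V)).
  rewrite (mxlogK As) -(mxlog_inv Es) (mxlogK (spd_inv Es)).
  exact: char_poly_whiten_quotient.
have C0 : char_poly (whiten P H) = char_poly (mxexp L *m mxexp V).
  rewrite (mxlogK As) (mxlogK Es) (char_poly_whiten_quotient H Ms Ps) -EE.
  by rewrite invmxK.
have [n1 [_ n1pos C1n L1]] := exp_majorization oU LU LU ls nVs C1.
have [n0 [_ n0pos C0n L0]] := exp_majorization oU LU LU ls Vs C0.
pose x1 := map_mx (@ln R) n1; pose x0 := map_mx (@ln R) n0.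
have O1 : Omega sqnorm H P' = frob x1 x1.
  by rewrite /Omega (symmetric_fun_eigvals _ sqnorm_sym C1n).
have O0 : Omega sqnorm H P = frob x0 x0.
  by rewrite /Omega (symmetric_fun_eigvals _ sqnorm_sym C0n).
have OM : Omega sqnorm H M = frob l l.
  rewrite (Omega_mxlog sqnorm_sym Ms Hs) -/A -/L LU.
  by rewrite (symmetric_eigvals _ sqnorm_sym oU).
have {}L1 : frob L (- V) <= frob l x1 - frob l l.
  apply: le_trans L1 _; rewrite !frob_rV -sumrB; apply: ler_sum => i _.
  by rewrite [x1 0 i]mxE mulrBr.
have {}L0 : frob L V <= frob l x0 - frob l l.
  apply: le_trans L0 _; rewrite !frob_rV -sumrB; apply: ler_sum => i _.
  by rewrite [x0 0 i]mxE mulrBr.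
have m1 : frob x1 x1 <= frob l l by rewrite -O1 -OM; exact: P'min.
have m0 : frob x0 x0 <= frob l l by rewrite -O0 -OM; exact: Pmin.
have dist : frob (x1 - l) (x1 - l) + frob (x0 - l) (x0 - l) <= 0.
  move: L1 L0 m1 m0; rewrite frobNr !frobBl !frobBr (frobC x1 l) (frobC x0 l).
  move: (frob L V) (frob l x1) (frob l x0) (frob x1 x1) (frob x0 x0) (frob l l).
  by clear; move=> a b c e f g; lra.
have x1l : x1 = l.
  apply/eqP; rewrite -subr_eq0; apply/eqP/frob_eq0/eqP.
  rewrite eq_le frob_ge0 andbT; apply: le_trans dist.
  by rewrite lerDl frob_ge0.
have x0l : x0 = l.
  apply/eqP; rewrite -subr_eq0; apply/eqP/frob_eq0/eqP.
  rewrite eq_le frob_ge0 andbT; apply: le_trans dist.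
  by rewrite lerDr frob_ge0.
have AU : char_poly A = \prod_(i < d) ('X - (expR (l 0 i))%:P).
  have -> : A = U *m diag_mx (map_mx expR l) *m U^T.
    by rewrite -[LHS](mxlogK As) -/L LU /mxexp (mxfunE expR l oU).
  rewrite (char_poly_conj_diag _ oU).
  by apply: eq_bigr => i _; rewrite mxE.
have n1E i : n1 0 i = expR (l 0 i).
  have e : ln (n1 0 i) = l 0 i by have /rowP/(_ i) := x1l; rewrite [LHS]mxE.
  rewrite -e; apply/esym/lnK; rewrite posrE; exact: n1pos.
have n0E i : n0 0 i = expR (l 0 i).
  have e : ln (n0 0 i) = l 0 i by have /rowP/(_ i) := x0l; rewrite [LHS]mxE.
  rewrite -e; apply/esym/lnK; rewrite posrE; exact: n0pos.
have tr1 : \tr (A *m invmx (whiten M P')) = \tr A.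
  apply: char_poly_eq_trace; rewrite -(char_poly_whiten_quotient H Ms Ps') C1n AU.
  by apply: eq_bigr => i _; rewrite n1E.
have tr0 : \tr (A *m whiten M P') = \tr A.
  apply: char_poly_eq_trace; rewrite AU.
  have -> : char_poly (A *m whiten M P') = char_poly (whiten P H).
    by rewrite (char_poly_whiten_quotient H Ms Ps) -EE invmxK.
  by rewrite C0n; apply: eq_bigr => i _; rewrite n0E.
have E1 := trace_inv_eq1 As Es tr0 tr1.
have E0 : whiten M P = 1%:M by rewrite -EE E1 invmx1.
have Ku := mxinvsqrt_unitmx Ms.
apply: (can_inj (mulKmx Ku)); apply: (can_inj (mulmxK Ku)).
by rewrite -/(whiten M P) -/(whiten M P') E0 E1.
Qed.

(** The squared norm is differentiable: test the subgradient at [X + D / 2], where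
    [D] is the difference to be shown zero. *)
Lemma sqnorm_subgradient X Z : sym X ->
  subdifferential sym (fun Y => sqnorm (eigvals Y)) X Z -> Z = 2 *: X.
Proof.
move=> Xs [Zs ZX]; have [D DE] : exists D, D = Z - 2 *: X by eexists.
have Ds : sym D by rewrite DE /sym /= linearB linearZ /= (Xs : _^T = _) (Zs : _^T = _).
have Ys : sym (X + 2^-1 *: D).
  by rewrite /sym /= linearD linearZ /= (Xs : _^T = _) (Ds : _^T = _).
apply/eqP; rewrite -subr_eq0 -DE; apply/eqP/frob_eq0/eqP.
rewrite eq_le frob_ge0 andbT.
have := ZX _ Ys; rewrite !sqnorm_eigvals // [X + _]addrC addrK.
have -> : Z = D + 2 *: X by rewrite DE subrK.
rewrite !frobDl !frobDr !frobZl !frobZr (frobC D X).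
move: (frob D D) (frob X D) (frob X X); clear => a b c; lra.
Qed.

End Uniqueness.

Section SingleObjective.
Context {R : realType} {d : nat}.

Definition coord0 (x : 'rV[R]_1) : R := x 0 0.

Lemma coord0_convex : convex coord0.
Proof. by move=> x y t _; rewrite /coord0 !mxE. Qed.

Lemma coord0_mono : coordinatewise_nondecreasing coord0.
Proof. by move=> i x y _; rewrite ord1. Qed.

Lemma coord0_subgradient (x theta : 'rV[R]_1) :
  subdifferential setT coord0 x theta <-> theta = const_mx 1.
Proof.
have fE (u v : 'rV[R]_1) : frob u v = u 0 0 * v 0 0 by rewrite frob_rV big_ord1.
split=> [[_ tx]|->]; last first.
  by split=> // y _; rewrite fE /coord0 !mxE mul1r subrKC.
apply/rowP => i; rewrite ord1 mxE.
have := tx (x + const_mx 1) I; have := tx (x - const_mx 1) I.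
rewrite !fE /coord0 !mxE; move: (x 0 0) (theta 0 0); clear => a b; lra.
Qed.

Lemma single_criterion (F : set 'M[R]_d) (H G : 'M[R]_d) (phi : 'rV[R]_d -> R) :
  F `<=` spd -> geodesically_convex F -> (exists k, embedded_submanifold k F) ->
  F G -> spd H -> convex phi -> permutation_invariant phi ->
  minimizes_over F (Omega phi H) G <->
  spectral_subdiff phi H G `&` whitened_normal F G !=set0.
Proof.
move=> Fspd Fconv Fsub FG Hs pc ps.
have /= crit := @minimizer_criterion _ _ 1 F (fun=> H) (fun=> phi) coord0 (fun=> Hs)
  (fun=> pc) (fun=> ps) coord0_convex coord0_mono G Fspd Fconv Fsub FG.
have OE : (fun G' => coord0 (Omegas (fun=> phi) (fun=> H) G')) = Omega phi H.
  by apply/funext => G'; rewrite /coord0 mxE.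
rewrite OE in crit; apply: iff_trans crit _; split.
  move=> [theta [Z [/coord0_subgradient -> ZG]]].
  by rewrite big_ord1 mxE scale1r => ZN; exists (Z 0); split=> //; exact: ZG.
move=> [Z [ZG ZN]]; exists (const_mx 1), (fun=> Z); split.
- exact/coord0_subgradient.
- by [].
- by rewrite big_ord1 mxE scale1r.
Qed.

End SingleObjective.

Theorem theorem3p6 (R : realType) (d : nat) (F : set 'M[R]_d)
    (F_nonempty : F !=set0) (F_spd : F `<=` spd) (F_closed : closed_in_spd F)
    (F_convex : geodesically_convex F)
    (F_submanifold : exists k : nat, embedded_submanifold k F) :
  (forall (q : nat) (H : 'I_q -> 'M[R]_d) (phi : 'I_q -> 'rV[R]_d -> R)
      (rho : 'rV[R]_q -> R),
    (forall a, spd (H a)) ->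
    (forall a, convex_function setT (phi a)) ->
    (forall a, permutation_invariant (phi a)) ->
    convex_function setT rho ->
    coordinatewise_nondecreasing rho ->
    forall G : 'M[R]_d, F G ->
      minimizes_over F (fun G' => rho (Omegas phi H G')) G <->
      exists (theta : 'rV[R]_q) (Z : 'I_q -> 'M[R]_d),
        [/\ subdifferential setT rho (Omegas phi H G) theta,
            forall a, spectral_subdiff (phi a) (H a) G (Z a)
          & whitened_normal F G (\sum_(a < q) theta 0 a *: Z a)])
  /\
  (forall (H : 'M[R]_d) (phi : 'rV[R]_d -> R),
    spd H ->
    convex_function setT phi ->
    permutation_invariant phi ->
    (exists! P : 'M[R]_d, nearest_point F H P) /\
    forall P : 'M[R]_d, nearest_point F H P ->
      whitened_normal F P (mxlog (whiten P H)) /\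
      (minimizes_over F (Omega phi H) P <->
       spectral_subdiff phi H P `&` whitened_normal F P !=set0)).
Proof.
split=> [q H phi rho Hs pc ps rc rm G FG|H phi Hs pc ps].
  apply: minimizer_criterion => // [a|]; exact/convex_functionP.
have [P0 P0min] := nearest_point_exists F_nonempty F_spd F_closed Hs.
split.
  exists P0; split=> // P Pmin.
  exact: (nearest_point_unique F_spd F_convex Hs P0min Pmin).
move=> P Pmin; have FP : F P by case: Pmin.
have Ps := F_spd P FP; split; last first.
  by apply: single_criterion => //; exact/convex_functionP.
have [Z [ZP [Zs ZN]]] : spectral_subdiff sqnorm H P `&` whitened_normal F P !=set0.
  apply/(single_criterion F_spd F_convex F_submanifold FP Hs sqnorm_convex sqnorm_sym).
  exact/nearest_pointP.
have Ls : sym (mxlog (whiten P H)) by exact: mxlog_sym (spd_whiten Ps Hs).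
split=> // V /ZN; rewrite (sqnorm_subgradient Ls ZP) frobZl => /eqP.
by rewrite mulf_eq0 pnatr_eq0 => /eqP.
Qed.
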